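(* Let $P, Q, R \in \mathbf{C}^{N\times N}$ be pairwise commuting matrices such that $Q$, $R$ and $R-Q$ are positive stable. Then $${}_3F_2\left(P,\tfrac{Q}{2},\tfrac{Q+I}{2};\tfrac{R}{2},\tfrac{R+I}{2};\tfrac{1}{2}\right) = 2^P \sum_{m=0}^\infty \binom{-P}{m} (R-Q)_m\,(R)_m^{-1}\; {}_2F_1\left(-mI,Q;R+mI;-1\right).$$
   Context: $\mathbf{C}^{N\times N}$ is the space of complex $N\times N$ matrices, $I$ is the identity matrix. A matrix $A\in\mathbf{C}^{N\times N}$ is positive stable if $\Re(\lambda)>0$ for every eigenvalue $\lambda$ of $A$. For $c>0$, $c^{A}=\exp(A\ln c)$. The matrix Pochhammer symbol is $(A)_0=I$, $(A)_m=A(A+I)\cdots(A+(m-1)I)$ for $m\ge 1$, and the matrix binomial coefficient is $\binom{-A}{m}=\frac{(-1)^m}{m!}(A)_m$. The generalized hypergeometric matrix function is defined by $${}_pF_q(P_1,\dots,P_p;Q_1,\dots,Q_q;z)=\sum_{m=0}^\infty \frac{(P_1)_m\cdots(P_p)_m(Q_1)_m^{-1}\cdots(Q_q)_m^{-1}}{m!}z^m,$$ where $P_i,Q_j\in\mathbf{C}^{N\times N}$ and each $Q_j+mI$ is invertible for all integers $m\ge 0$.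
   Formalization: The series on the right diverges for some admissible P (e.g. N=1, P=10, Q=1, R=2), so the identity is proved whenever that series converges; convergence of the series on the left is proved. *)

(* Defs.v *)
From HB Require Import structures.
From mathcomp Require Import all_boot all_order all_algebra complex.
From mathcomp Require Import all_classical all_reals all_analysis.

Set Implicit Arguments.
Unset Strict Implicit.
Unset Printing Implicit Defensive.

Import Order.TTheory GRing.Theory Num.Theory numFieldNormedType.Exports.

Local Open Scope classical_set_scope.
Local Open Scope ring_scope.

(* The definitions that do not involve the real part are given over an         *)
(* abstract K : numFieldType, whose norm topology the library provides under   *)
(* that name; on the concrete type F[i] it is only reachable through F[i]^o.   *)

Section MatrixFunctions.
Context (K : numFieldType) (N : nat).
Implicit Types (A : 'M[K]_N) (u : nat -> 'M[K]_N) (Ps Qs : seq 'M[K]_N).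

Definition mxseries_cvg u : Prop := cvg (series u @ \oo).

(* A junk value when the series diverges. *)
Definition mxseries_sum u : 'M[K]_N := lim (series u @ \oo).

Definition mxexp A : 'M[K]_N := mxseries_sum (fun k => k`!%:R^-1 *: A ^+ k).

Definition mxpoch A (m : nat) : 'M[K]_N := \prod_(k < m) (A + (k%:R)%:M).

(* The binomial coefficient with upper entry - A and lower entry m. *)
Definition mxbinN A (m : nat) : 'M[K]_N := ((-1) ^+ m / m`!%:R) *: mxpoch A m.

(* invmx is total: the intended inverse only when every B + k%:R%:M, B \in Qs, *)
(* is invertible, which is the domain of definition of the function.           *)
Definition pFq_term Ps Qs (z : K) (m : nat) : 'M[K]_N :=
  (z ^+ m / m`!%:R) *:
    ((\prod_(A <- Ps) mxpoch A m) * (\prod_(B <- Qs) invmx (mxpoch B m))).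

Definition pFq Ps Qs (z : K) : 'M[K]_N := mxseries_sum (pFq_term Ps Qs z).

End MatrixFunctions.

Definition positive_stable (F : realType) (N : nat) (A : 'M[F[i]]_N) : Prop :=
  forall a : F[i], eigenvalue A a -> 0 < complex.Re a.

(* Meant for 0 < c. *)
Definition mxpowR (F : realType) (N : nat) (c : F) (A : 'M[F[i]]_N) :
  'M[F[i]]_N := mxexp ((ln c)%:C%C *: A).

(* Main.v *)
Require Import Defs.
From HB Require Import structures.
From mathcomp Require Import all_boot all_order all_algebra complex.
From mathcomp Require Import all_classical all_reals all_analysis.
From mathcomp Require Import ring lra.

Set Implicit Arguments.
Unset Strict Implicit.
Unset Printing Implicit Defensive.

Import Order.TTheory GRing.Theory Num.Theory numFieldNormedType.Exports.

Local Open Scope ring_scope.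

(* Put nu_j = (Q)_(2j) (R)_(2j)^-1. Duplication turns the left-hand series into *)
(* sum_j (P)_j / j! nu_j 2^-j. The linear functional sending X^k to             *)
(* (Q)_k (R)_k^-1, evaluated at (1-X)^m (1+X)^m = (1-X^2)^m in two ways, turns  *)
(* the m-th term on the right into                                              *)
(*   b_m = (-1)^m (P)_m / m! sum_j (-1)^j C(m,j) nu_j.                          *)
(* Euler's (E,1) summation method is regular, so sum_m b_m, when it converges,  *)
(* equals sum_k 2^-k sum_m C(k-1,m-1) b_m. By the Chu-Vandermonde identity the  *)
(* latter is the Cauchy product of sum_n (-P)_n / n! 2^-n = 2^(-P) with the     *)
(* left-hand series, both absolutely convergent. The binomial series at 1/2 is  *)
(* identified with an exponential by comparing two one-parameter semigroups     *)
(* with the same generator.                                                     *)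

(** * Real sequences and binomial means *)

(** Formally, let t be the variable of the Beta-type functional with moments (Q)_k (R)_k^-1. The
    left side is the value of (1 - t^2/2)^(-P) under this functional. Since 1 - t^2/2 = (1 + (1 -
    t^2))/2, this is 2^P (1 + (1 - t^2))^(-P), and expanding in powers of 1 - t^2 = (1 - t)(1 + t)
    gives the right side: [lhs_termE] and [rhs_termE], the latter through [moment_beta_sum].

    At t = 0 the expansion sits on the boundary of its disc of convergence, so it cannot be
    rearranged directly. [euler_mcvg] replaces the right-hand series by its Euler transform with the
    same sum; [binomial_transform_coef] recognizes that transform as a Cauchy product, and
    [mcvg_cauchy] sums it. The scalar-like factor is handled by [binomial_sum_half], which rests on
    [semigroup_unique], and by [mxpowRN]. *)

(** These are the terms of a convergent series: its partial sums [s i M] increase and stay below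
    2. *)
Lemma bin_half_pow_cvg0 (F : realType) (i : nat) :
  ('C(n, i)%:R * 2^-1 ^+ n @[n --> \oo] --> (0 : F))%classic.
Proof.
pose s j M : F := \sum_(0 <= n < M) 'C(n, j)%:R * 2^-1 ^+ n.
have s_le2 j M : s j M <= 2.
  elim: j M => [|j IHj] M.
    suff -> : s 0%N M = 2 - 2 * 2^-1 ^+ M.
      by rewrite gerBl mulr_ge0 // exprn_ge0 // invr_ge0.
    elim: M => [|M IHM]; first by rewrite /s big_nil expr0; lra.
    rewrite /s big_nat_recr //= -/(s 0%N M) IHM bin0 exprS; lra.
  (* By Pascal's rule the right side is [s j.+1 M.+1], which is at least [s j.+1 M]; hence
     [s j.+1 M <= s j M]. *)
  suff : s j.+1 M <= (s j.+1 M + s j M) / 2 by have := IHj M; lra.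
  have -> : (s j.+1 M + s j M) / 2 = s j.+1 M.+1.
    rewrite /s big_nat_recl //= mul0r add0r -big_split /= big_distrl /=.
    by apply: eq_bigr => n _; rewrite binS natrD exprS; lra.
  rewrite {2}/s big_nat_recr //= -/(s j.+1 M) lerDl.
  by rewrite mulr_ge0 // exprn_ge0 // invr_ge0.
apply: cvg_series_cvg_0; apply: nondecreasing_is_cvgn.
  apply/nondecreasing_seqP => M; rewrite /series /= big_nat_recr //= lerDl.
  by rewrite mulr_ge0 // exprn_ge0 // invr_ge0.
by exists 2 => _ [M _ <-]; exact: s_le2.
Qed.

Lemma cvg_sum0 (F : realType) (I : Type) (r : seq I) (f : I -> nat -> F) :
  (forall i, (f i k @[k --> \oo] --> (0 : F))%classic) ->
  (\sum_(i <- r) f i k @[k --> \oo] --> (0 : F))%classic.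
Proof.
move=> f0; elim: r => [|j r IHr].
  by under eq_fun do rewrite big_nil; exact: cvg_cst.
under eq_fun do rewrite big_cons.
by rewrite -[X in nbhs X](addr0 (0 : F)); apply: cvgD.
Qed.

Lemma sum_bin (n : nat) : (\sum_(i < n.+1) 'C(n, i) = 2 ^ n)%N.
Proof.
rewrite -[2%N]/(1 + 1)%N expnDn; apply: eq_bigr => i _.
by rewrite !exp1n !muln1.
Qed.

(** Toeplitz's argument: the weights C(n,i) 2^-n sum to 1 over i, so the indices where r is small
    contribute little, while the finitely many others have weights tending to 0. *)
Lemma binomial_mean_cvg0 (F : realType) (r : nat -> F) :
  (forall i, 0 <= r i) -> (r k @[k --> \oo] --> (0 : F))%classic ->
  ((\sum_(i < n.+1) 'C(n, i)%:R * r i) * 2^-1 ^+ n @[n --> \oo]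
     --> (0 : F))%classic.
Proof.
move=> r_ge0 r_cvg0; apply/cvgrPdist_lt => e e0.
have e2 : 0 < e / 2 by rewrite divr_gt0.
move/cvgrPdist_lt/(_ _ e2): r_cvg0 => [n0 _ r_small].
have : (\sum_(i < n0) ('C(n, i)%:R * 2^-1 ^+ n) * r i @[n --> \oo]
     --> (0 : F))%classic.
  apply: (@cvg_sum0 _ _ _ (fun (i : 'I_n0) n => ('C(n, i)%:R * 2^-1 ^+ n) * r i)) => i.
  rewrite -(mul0r (r i)).
  by apply: cvgM; [exact: bin_half_pow_cvg0|exact: cvg_cst].
move/cvgrPdist_lt/(_ _ e2) => head_small.
near=> n.
have n0n : (n0 <= n.+1)%N by apply: leqW; near: n; exact: nbhs_infty_ge.
have : `|0 - \sum_(i < n0) 'C(n, i)%:R * 2^-1 ^+ n * r i| < e / 2.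
  by near: n.
rewrite !sub0r !normrN => /ltr_normlW headn.
have p0 : 0 <= 2^-1 ^+ n :> F by rewrite exprn_ge0 // invr_ge0.
rewrite ger0_norm; last first.
  by rewrite mulr_ge0 // sumr_ge0 // => i _; rewrite mulr_ge0.
suff : (\sum_(i < n.+1) 'C(n, i)%:R * r i) * 2^-1 ^+ n <=
   e / 2 + \sum_(i < n0) 'C(n, i)%:R * 2^-1 ^+ n * r i by lra.
(* Spread e / 2 over the weights, so that the comparison can be made term by term. *)
have -> : e / 2 = \sum_(i < n.+1) ('C(n, i)%:R * (e / 2)) * 2^-1 ^+ n.
  rewrite -!big_distrl /= -natr_sum sum_bin natrX mulrAC -exprMn divff //.
  by rewrite expr1n mul1r.
rewrite (big_ord_widen _ (fun i => 'C(n, i)%:R * 2^-1 ^+ n * r i) n0n).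
rewrite [X in _ <= _ + X]big_mkcond /= -big_split /= big_distrl /=.
apply: ler_sum => i _; case: ltnP => [i_lt|i_ge].
  rewrite mulrAC lerDr; do ?apply: mulr_ge0 => //; exact: ltW.
rewrite addr0; apply: ler_wpM2r => //; apply: ler_wpM2l => //.
have /= := r_small i i_ge; rewrite sub0r normrN ger0_norm //; exact: ltW.
Unshelve. all: by end_near. Qed.

(** Supplies the vanishing upper bound for the corner sums in [cauchy_square_cvg0]. *)
Lemma cvg_half_pow_sub0 (F : realType) (c : nat -> F) :
  (forall n, 0 <= c n) -> cvgn c -> (c n.*2 - c n @[n --> \oo] --> (0:F))%classic.
Proof.
move=> c0 cc; rewrite -(subrr (limn c)); apply: cvgB; last exact: cc.
apply: (cvg_comp _ c); last exact: cc.
move=> A [n0 _ n0A]; exists n0 => // n /= n0n; apply: n0A => /=.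
by rewrite -addnn (leq_trans n0n) // leq_addl.
Qed.

(** * Entrywise norm and convergence of complex matrices *)

(* F[i] carries the norm topology only as an abstract numFieldType, so         *)
(* topological limits of matrices are handled here before specializing K.      *)
Section MatrixLimit.
Context (K : numFieldType) (N : nat).
Implicit Types (u : nat -> 'M[K]_N) (l : 'M[K]_N).

Definition mxtends u l : Prop := (u n @[n --> \oo] --> l)%classic.

Lemma mxtendsP u l : mxtends u l <->
  forall e : K, 0 < e -> exists n0, forall n, (n0 <= n)%N ->
    forall i j, `|l i j - u n i j| < e.
Proof.
split => [/cvg_ballP ul e e0 | ul].
  have [n0 _ n0P] := ul e e0; exists n0 => n /n0P [_ unl] i j.
  exact: unl.
apply/cvg_ballP => e e0; have [n0 n0P] := ul e e0.
exists n0 => // n /= /n0P unl; split => // i j; exact: unl.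
Qed.

Lemma mxtends_unique u l l' : mxtends u l -> mxtends u l' -> l = l'.
Proof.
move=> ul ul'.
by rewrite -(cvg_lim (@norm_hausdorff _ _) ul) -(cvg_lim (@norm_hausdorff _ _) ul').
Qed.

Lemma mxseries_cvg_tends u :
  mxseries_cvg u <-> exists l, mxtends (series u) l.
Proof. by split=> [cu|[l ul]]; [exists (mxseries_sum u)|apply/cvg_ex; exists l]. Qed.

Lemma mxseries_sum_tends u l : mxtends (series u) l -> mxseries_sum u = l.
Proof. exact: (cvg_lim (@norm_hausdorff _ _)). Qed.

End MatrixLimit.

Section MatrixNorm.
Context (F : realType) (N : nat).
Implicit Types (A B : 'M[F[i]]_N) (a : F[i]) (u v : nat -> 'M[F[i]]_N).

Local Notation normc := (@Normc.normc F).

Lemma normc_ge0 a : 0 <= normc a.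
Proof. by case: a => x y; exact: sqrtr_ge0. Qed.

Lemma normcR (x : F) : normc x%:C%C = `|x|.
Proof. by rewrite /= expr0n addr0 sqrtr_sqr. Qed.

Lemma normc_lt a (e : F) : (`|a| < e%:C%C) = (normc a < e).
Proof. by rewrite normc_def ltcR; case: a. Qed.

Lemma Re_le_normc a : `|complex.Re a| <= normc a.
Proof.
by case: a => x y; rewrite -sqrtr_sqr ler_wsqrtr // lerDl sqr_ge0.
Qed.

Lemma Im_le_normc a : `|complex.Im a| <= normc a.
Proof.
by case: a => x y; rewrite -sqrtr_sqr ler_wsqrtr // lerDr sqr_ge0.
Qed.

Lemma normc_le_ReIm a : normc a <= `|complex.Re a| + `|complex.Im a|.
Proof.
case: a => x y /=; rewrite -[leRHS]ger0_norm ?addr_ge0 // -sqrtr_sqr.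
rewrite ler_wsqrtr // sqrrD !real_normK ?num_real // addrAC lerDl.
by rewrite mulrn_wge0 // mulr_ge0.
Qed.

(* Submultiplicative but not normalized (mnorm 1 = N), so factors close to 1    *)
(* are always estimated as 1 + E acting on a matrix.                           *)
Definition mnorm A : F := \sum_i \sum_j normc (A i j).

Lemma mnorm_ge0 A : 0 <= mnorm A.
Proof. by apply: sumr_ge0 => i _; apply: sumr_ge0 => j _; exact: normc_ge0. Qed.

Lemma normc_le_mnorm A i j : normc (A i j) <= mnorm A.
Proof.
rewrite /mnorm (bigD1 i) //= (bigD1 j) //= -addrA lerDl addr_ge0 //.
  by apply: sumr_ge0 => k _; exact: normc_ge0.
by apply: sumr_ge0 => k _; apply: sumr_ge0 => k' _; exact: normc_ge0.
Qed.

Lemma mnorm0 : mnorm 0 = 0.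
Proof.
by rewrite /mnorm big1 // => i _; rewrite big1 // => j _; rewrite mxE Normc.normc0.
Qed.

Lemma mnorm_eq0 A : mnorm A = 0 -> A = 0.
Proof.
move=> A0; apply/matrixP => i j; rewrite mxE; apply: Normc.eq0_normc.
by apply/eqP; rewrite eq_le normc_ge0 andbT -A0 normc_le_mnorm.
Qed.

Lemma mnormD A B : mnorm (A + B) <= mnorm A + mnorm B.
Proof.
rewrite /mnorm -big_split; apply: ler_sum => i _ /=.
rewrite -big_split; apply: ler_sum => j _ /=; rewrite mxE; exact: le_normcD.
Qed.

Lemma mnormZ a A : mnorm (a *: A) = normc a * mnorm A.
Proof.
rewrite /mnorm mulr_sumr; apply: eq_bigr => i _.
by rewrite mulr_sumr; apply: eq_bigr => j _; rewrite mxE Normc.normcM.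
Qed.

Lemma mnormN A : mnorm (- A) = mnorm A.
Proof.
by apply: eq_bigr => i _; apply: eq_bigr => j _; rewrite mxE normcN.
Qed.

Lemma mnormB A B : mnorm (A - B) <= mnorm A + mnorm B.
Proof. by rewrite -(mnormN B) mnormD. Qed.

Lemma mnorm_sum I (r : seq I) (Pr : pred I) (f : I -> 'M[F[i]]_N) :
  mnorm (\sum_(i <- r | Pr i) f i) <= \sum_(i <- r | Pr i) mnorm (f i).
Proof.
elim/big_rec2: _ => [|i x A _ Ax]; first by rewrite mnorm0.
by apply: le_trans (mnormD _ _) _; rewrite lerD2l.
Qed.

Lemma normc_sum I (r : seq I) (Pr : pred I) (f : I -> F[i]) :
  normc (\sum_(i <- r | Pr i) f i) <= \sum_(i <- r | Pr i) normc (f i).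
Proof.
elim/big_rec2: _ => [|i x a _ ax]; first by rewrite Normc.normc0.
by apply: le_trans (le_normcD _ _) _; rewrite lerD2l.
Qed.

Lemma mnormM A B : mnorm (A *m B) <= mnorm A * mnorm B.
Proof.
rewrite {1 2}/mnorm mulr_suml; apply: ler_sum => i _.
rewrite mulr_suml.
apply: (@le_trans _ _ (\sum_j \sum_k normc (A i k) * normc (B k j))).
  apply: ler_sum => j _; rewrite mxE; apply: le_trans (normc_sum _ _ _) _.
  by apply: ler_sum => k _; rewrite Normc.normcM.
rewrite exchange_big; apply: ler_sum => k _ /=.
rewrite -mulr_sumr ler_wpM2l ?normc_ge0 //.
rewrite /mnorm [leRHS](bigD1 k) //= lerDl.
by apply: sumr_ge0 => l _; apply: sumr_ge0 => j _; exact: normc_ge0.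
Qed.

(** Stated as the limit of a real sequence, so that the real limit calculus applies; [mcvgP] ties it
    to the topology behind [mxseries_sum]. *)
Definition mcvg u (l : 'M[F[i]]_N) : Prop :=
  (mnorm (u n - l) @[n --> \oo] --> (0 : F))%classic.

Lemma squeeze0 (f g : nat -> F) : (forall n, 0 <= f n <= g n) ->
  (g n @[n --> \oo] --> (0 : F))%classic -> (f n @[n --> \oo] --> (0 : F))%classic.
Proof.
move=> fg g0; apply: (squeeze_cvgr _ _ g0); last exact: cvg_cst.
by apply: nearW.
Qed.

Lemma mcvg_le u l (g : nat -> F) : (forall n, mnorm (u n - l) <= g n) ->
  (g n @[n --> \oo] --> (0 : F))%classic -> mcvg u l.
Proof. by move=> ug; apply: squeeze0 => n; rewrite mnorm_ge0 ug. Qed.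

Lemma mcvgP u l : mcvg u l <-> mxtends u l.
Proof.
rewrite mxtendsP; split=> [ul e | ul].
  rewrite ltcE => /andP[/= /eqP e_im e_re].
  move/cvgrPdist_lt/(_ _ e_re): ul => [n0 _ n0P]; exists n0 => n /n0P /=.
  rewrite sub0r normrN ger0_norm ?mnorm_ge0 // => uln i j.
  have -> : e = (complex.Re e)%:C%C by case: (e) e_im => x y /= ->.
  rewrite normc_lt; apply: le_lt_trans uln.
  by rewrite -mnormN opprB; have := normc_le_mnorm (l - u n) i j; rewrite !mxE.
apply/cvgrPdist_lt => e e0.
(* The successor keeps the denominator positive for N = 0 and the sum of the N^2 entry bounds
   strictly below e. *)
have eN : 0 < e / (N * N).+1%:R by rewrite divr_gt0 // ltr0n.
have [|n0 n0P] := ul (e / (N * N).+1%:R)%:C%C.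
  by rewrite ltcE /= eqxx.
exists n0 => // n /= /n0P uln; rewrite sub0r normrN ger0_norm ?mnorm_ge0 //.
rewrite -mnormN opprB /mnorm.
apply: (@le_lt_trans _ _ (\sum_(i < N) \sum_(j < N) e / (N * N).+1%:R)).
  apply: ler_sum => i _; apply: ler_sum => j _; rewrite !mxE ltW //.
  by rewrite -normc_lt; exact: uln.
rewrite !sumr_const !card_ord -mulrnA -[ltLHS]mulr_natr -mulrA gtr_pMr //.
by rewrite mulrC ltr_pdivrMr ?ltr0n // mul1r ltr_nat.
Qed.

Lemma mcvg_unique u l l' : mcvg u l -> mcvg u l' -> l = l'.
Proof. by move=> /mcvgP ul /mcvgP; exact: mxtends_unique. Qed.

Lemma mxseries_cvgP u : mxseries_cvg u <-> exists l, mcvg (series u) l.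
Proof. by rewrite mxseries_cvg_tends; split=> -[l /mcvgP]; exists l. Qed.

Lemma mxseries_sumE u l : mcvg (series u) l -> mxseries_sum u = l.
Proof. by move/mcvgP/mxseries_sum_tends. Qed.

Lemma mcvgD u v l m : mcvg u l -> mcvg v m -> mcvg (fun n => u n + v n) (l + m).
Proof.
move=> ul vm; apply: (@mcvg_le _ _ (fun n => mnorm (u n - l) + mnorm (v n - m))).
  by move=> n; rewrite opprD addrACA mnormD.
by rewrite -(addr0 (0 : F)); apply: cvgD.
Qed.

End MatrixNorm.

(** * Absolutely convergent series of matrices *)

(** The triangle k + l < n, cut along antidiagonals on the left and along rows on the right. *)
Lemma triangle_sum (V : zmodType) (f : nat -> nat -> V) (n : nat) :
  \sum_(0 <= m < n) \sum_(k < m.+1) f k (m - k)%N =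
    \sum_(0 <= k < n) \sum_(0 <= l < n - k) f k l.
Proof.
rewrite big_mkord.
transitivity (\sum_(m < n) \sum_(k < n | (k < m.+1)%N) f k (m - k)%N).
  apply: eq_bigr => m _.
  exact: (big_ord_widen n (fun k : nat => f k (m - k)%N) (ltn_ord m)).
rewrite (exchange_big_dep predT) //= big_mkord; apply: eq_bigr => k _.
have -> : \sum_(0 <= l < n - k) f k l = \sum_(k <= m < n) f k (m - k)%N.
  rewrite -[X in _ = \sum_(X <= _ < n) _]add0n big_addn; apply: eq_bigr => l _.
  by rewrite addnK.
rewrite -(big_mkord (fun m => (k < m.+1)%N) (fun m => f k (m - k)%N)).
rewrite (@big_cat_nat _ _ _ k 0 n) //= ?(ltnW (ltn_ord k)) //.
rewrite big1_seq ?add0r; last first.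
  by move=> m /andP[]; rewrite mem_index_iota ltnS => km /andP[_]; rewrite ltnNge km.
rewrite big_nat_cond [RHS]big_nat_cond; apply: eq_bigl => m.
by rewrite ltnS andbT; case: (k <= m)%N; rewrite ?andbT.
Qed.

Lemma square_sub_triangle (V : zmodType) (f : nat -> nat -> V) (n : nat) :
  \sum_(0 <= k < n) \sum_(0 <= l < n) f k l
    - \sum_(0 <= m < n) \sum_(k < m.+1) f k (m - k)%N
  = \sum_(0 <= k < n) \sum_(n - k <= l < n) f k l.
Proof.
rewrite triangle_sum -sumrB; apply: eq_big_nat => k /andP[_ kn].
rewrite (@big_cat_nat _ _ _ (n - k) 0 n) //= ?leq_subr //.
by rewrite addrC addrK.
Qed.

Section CauchyProduct.
Context (F : realType).
Implicit Types w z : nat -> F.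

(** The square of side n contains the triangle k + l < n and lies in the triangle k + l < 2n, so the
    corner is at most [c n.*2 - c n]. The triangle sums [c] converge, being monotone and bounded by
    the product of the two sums. *)
Lemma cauchy_square_cvg0 w z : (forall n, 0 <= w n) -> (forall n, 0 <= z n) ->
  cvgn (series w) -> cvgn (series z) ->
  (\sum_(0 <= k < n) \sum_(n - k <= l < n) w k * z l @[n --> \oo]
     --> (0 : F))%classic.
Proof.
move=> w0 z0 cw cz.
pose c n := \sum_(0 <= m < n) \sum_(k < m.+1) w k * z (m - k)%N.
pose sq n := \sum_(0 <= k < n) \sum_(0 <= l < n) w k * z l.
have sqE n : sq n = series w n * series z n.
  by rewrite /sq /series /= mulr_suml; apply: eq_bigr => k _; rewrite mulr_sumr.
have wz0 k l : 0 <= w k * z l by rewrite mulr_ge0.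
have sqc n : sq n - c n = \sum_(0 <= k < n) \sum_(n - k <= l < n) w k * z l.
  exact: (square_sub_triangle (fun k l => w k * z l)).
have c_le n : c n <= sq n.
  by rewrite -subr_ge0 sqc; apply: sumr_ge0 => k _; apply: sumr_ge0.
have c_homo : {homo c : n m / (n <= m)%N >-> n <= m}.
  apply/nondecreasing_seqP => n; rewrite /c big_nat_recr //= lerDl.
  exact: sumr_ge0.
have sq_le n : sq n <= c n.*2.
  have := sqc n.*2; rewrite /sq.
  move/eqP; rewrite subr_eq addrC -subr_eq => /eqP <-.
  rewrite -sumrB [leRHS](@big_cat_nat _ _ _ n 0 n.*2) //=; last first.
    by rewrite -addnn leq_addr.
  rewrite -[leLHS]addr0; apply: lerD; last first.
    apply: sumr_ge0 => k _; rewrite (@big_cat_nat _ _ _ (n.*2 - k)%N 0 n.*2) //=.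
      by rewrite addrK sumr_ge0.
    exact: leq_subr.
  rewrite big_nat_cond [leRHS]big_nat_cond; apply: ler_sum => k.
  rewrite andbT leq0n /= => kn.
  rewrite [in leRHS](@big_cat_nat _ _ _ (n.*2 - k)%N 0 n.*2) ?leq_subr //=.
  rewrite addrK (@big_cat_nat _ _ _ n 0 (n.*2 - k)%N) //=.
    by rewrite lerDl sumr_ge0.
  by rewrite -addnn -addnBA ?leq_addr // ltnW.
have cc : cvgn c.
  apply: nondecreasing_is_cvgn => //.
  have [M wzM] : exists M, forall n, sq n <= M.
    have hw : cvgn (fun n => series w n * series z n) by exact: is_cvgM.
    exists (limn (fun n => series w n * series z n)) => n; rewrite sqE.
    apply: (nondecreasing_cvgn_le _ hw).
    apply/nondecreasing_seqP => m; apply: ler_pM; rewrite /series /=.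
    - exact: sumr_ge0.
    - exact: sumr_ge0.
    - by rewrite big_nat_recr //= lerDl.
    - by rewrite big_nat_recr //= lerDl.
  by exists M => _ [n _ <-]; exact: le_trans (c_le n) (wzM n).
under eq_fun do rewrite -sqc.
apply: (@squeeze0 _ _ (fun n => c n.*2 - c n)) => [n|].
  by rewrite subr_ge0 c_le lerD2r sq_le.
apply: cvg_half_pow_sub0 => // n.
by apply: sumr_ge0 => m _; apply: sumr_ge0.
Qed.

End CauchyProduct.

Lemma ratio_cvg (F : realType) (w : nat -> F) (q : F) n0 :
  (forall n, 0 <= w n) -> 0 < q < 1 ->
  (forall n, (n0 <= n)%N -> w n.+1 <= q * w n) -> cvgn (series w).
Proof.
move=> w0 /andP[q0 q1] wq.
(* A sum instead of a maximum: it dominates every [w k / q ^+ k] with k <= n0, and the ratio bound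
   carries [w n <= B * q ^+ n] further. *)
pose B := \sum_(0 <= k < n0.+1) w k / q ^+ k.
have q_ge0 := ltW q0.
have B0 : 0 <= B.
  by apply: sumr_ge0 => k _; rewrite divr_ge0 // exprn_ge0.
have small n : (n <= n0)%N -> w n <= B * q ^+ n.
  move=> nn0; rewrite -ler_pdivrMr ?exprn_gt0 //.
  rewrite /B big_mkord (bigD1 (Ordinal (nn0 : (n < n0.+1)%N))) //= lerDl.
  by apply: sumr_ge0 => k _; rewrite divr_ge0 // exprn_ge0.
apply: (@series_le_cvg _ _ (fun n => B * q ^+ n)) => // [n|n|].
- by rewrite mulr_ge0 // exprn_ge0.
- elim: n => [|n IHn]; first exact: small.
  case: (leqP n.+1 n0) => [|n0n]; first exact: small.
  apply: le_trans (wq n n0n) _.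
  by rewrite exprS mulrCA ler_wpM2l.
- by apply: is_cvg_geometric_series; rewrite ger0_norm.
Qed.

Section MatrixSeries.
Context (F : realType) (N : nat).
Implicit Types (A B : 'M[F[i]]_N) (a : F[i]) (u v : nat -> 'M[F[i]]_N).

Local Notation normc := (@Normc.normc F).

Definition abscvg u : Prop := cvgn (series (fun n => mnorm (u n))).

Lemma abscvg_le u (w : nat -> F) : (forall n, mnorm (u n) <= w n) ->
  cvgn (series w) -> abscvg u.
Proof.
move=> uw; apply: series_le_cvg => // n; first exact: mnorm_ge0.
exact: le_trans (mnorm_ge0 _) (uw n).
Qed.

(** Completeness is drawn from the reals: the real and imaginary parts of each entry form absolutely
    convergent series. *)
Lemma abscvg_mcvg u : abscvg u -> exists l, mcvg (series u) l.
Proof.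
move=> cu.
have cpart (f : F[i] -> F) : (forall a, `|f a| <= normc a) ->
    forall i j, cvgn (series (fun n => f (u n i j))).
  move=> f_le i j; apply: normed_cvg.
  apply: (@series_le_cvg _ _ (fun n => mnorm (u n))) => // n.
  - exact: normr_ge0.
  - exact: mnorm_ge0.
  exact: le_trans (f_le _) (normc_le_mnorm _ _ _).
have cRe := cpart _ (@Re_le_normc F).
have cIm := cpart _ (@Im_le_normc F).
pose lRe i j := limn (series (fun n => complex.Re (u n i j))).
pose lIm i j := limn (series (fun n => complex.Im (u n i j))).
exists (\matrix_(i, j) (lRe i j +i* lIm i j)%C).
apply: (@mcvg_le _ _ _ _ (fun n => \sum_i \sum_j
   (`|series (fun n => complex.Re (u n i j)) n - lRe i j| +
    `|series (fun n => complex.Im (u n i j)) n - lIm i j|))).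
  move=> n; apply: ler_sum => i _; apply: ler_sum => j _.
  apply: le_trans (normc_le_ReIm _) _.
  by rewrite !mxE summxE !raddfB /= !raddf_sum.
pose g i j n := `|series (fun n => complex.Re (u n i j)) n - lRe i j| +
  `|series (fun n => complex.Im (u n i j)) n - lIm i j|.
apply: (@cvg_sum0 _ _ _ (fun i n => \sum_j g i j n)) => i.
apply: (@cvg_sum0 _ _ _ (fun j n => g i j n)) => j; rewrite /g.
rewrite -(addr0 (0 : F)).
apply: cvgD; apply/norm_cvg0P.
  by rewrite -(subrr (lRe i j)); apply: cvgB; [exact: cRe|exact: cvg_cst].
by rewrite -(subrr (lIm i j)); apply: cvgB; [exact: cIm|exact: cvg_cst].
Qed.

Lemma mnorm_lim_le u l M : mcvg u l -> (forall n, mnorm (u n) <= M) ->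
  mnorm l <= M.
Proof.
move=> /cvgrPdist_lt ul uM; apply/ler_addgt0Pr => e e0.
have [n0 _ /(_ n0 (leqnn n0))] := ul e e0; rewrite /= sub0r normrN.
rewrite ger0_norm ?mnorm_ge0 // => un0.
have := mnormB (u n0) (u n0 - l); rewrite opprB addrC subrK.
by have := uM n0; lra.
Qed.

(** The Cauchy partial sum differs from the product of partial sums by a corner sum, dominated in
    norm by the one in [cauchy_square_cvg0]. *)
Lemma mcvg_cauchy u v U V : abscvg u -> abscvg v ->
  mcvg (series u) U -> mcvg (series v) V ->
  mcvg (series (fun n => \sum_(k < n.+1) u k *m v (n - k)%N)) (U *m V).
Proof.
move=> cu cv uU vV.
pose r n := \sum_(0 <= k < n) \sum_(n - k <= l < n) mnorm (u k) * mnorm (v l).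
pose M := limn (series (fun n => mnorm (v n))).
apply: (@mcvg_le _ _ _ _ (fun n => r n + (mnorm (series u n - U) * M
    + mnorm U * mnorm (series v n - V)))).
  move=> n; set c := series _ n.
  have -> : c - U *m V = - (series u n *m series v n - c)
      + ((series u n - U) *m series v n + U *m (series v n - V)).
    by rewrite opprB mulmxBl mulmxBr !addrA !subrK.
  apply: le_trans (mnormD _ _) _; apply: lerD.
    have -> : series u n *m series v n =
        \sum_(0 <= k < n) \sum_(0 <= l < n) u k *m v l.
      by rewrite /series /= mulmx_suml; apply: eq_bigr => k _; rewrite mulmx_sumr.
    rewrite mnormN (square_sub_triangle (fun k l => u k *m v l)).
    apply: le_trans (mnorm_sum _ _ _) _; apply: ler_sum => k _.
    apply: le_trans (mnorm_sum _ _ _) _; apply: ler_sum => l _.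
    exact: mnormM.
  apply: le_trans (mnormD _ _) _; apply: lerD; last exact: mnormM.
  apply: le_trans (mnormM _ _) _; rewrite ler_wpM2l ?mnorm_ge0 //.
  apply: le_trans (mnorm_sum _ _ _) _.
  apply: (nondecreasing_cvgn_le _ cv).
  apply/nondecreasing_seqP => m.
  by rewrite /series /= big_nat_recr //= lerDl mnorm_ge0.
rewrite -(addr0 (0 : F)); apply: cvgD.
  by apply: cauchy_square_cvg0 => // n; exact: mnorm_ge0.
rewrite -(addr0 (0 : F)); apply: cvgD.
  by rewrite -(mul0r M); apply: cvgM => //; exact: cvg_cst.
by rewrite -(mulr0 (mnorm U)); apply: cvgM => //; exact: cvg_cst.
Qed.

Lemma normc_half_pow n : normc (2^-1 ^+ n) = 2^-1 ^+ n.
Proof.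
have -> : 2^-1 ^+ n = (2^-1 ^+ n)%:C%C :> F[i].
  by rewrite rmorphXn fmorphV rmorph_nat.
by rewrite normcR ger0_norm // exprn_ge0 // invr_ge0.
Qed.

Lemma normc_nat n : normc n%:R = n%:R.
Proof. by rewrite -(rmorph_nat (real_complex F)) normcR normr_nat. Qed.

(* 2^-k times this is the k-th term of the (E,1) transform of the series of b. *)
Definition euler_term (b : nat -> 'M[F[i]]_N) k : 'M[F[i]]_N :=
  if k is k'.+1 then \sum_(m < k'.+1) 'C(k', m)%:R *: b m.+1 else b 0%N.

(** Pascal's rule and induction. The indices are shifted because [series b i] sums only the terms
    before i. *)
Lemma euler_mean b n :
  series (fun k => 2^-1 ^+ k *: euler_term b k) n.+1 =
  2^-1 ^+ n *: \sum_(i < n.+1) 'C(n, i)%:R *: series b i.+1.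
Proof.
elim: n => [|n IHn].
  by rewrite big_ord1 /series /= !big_nat1 !expr0 !scale1r.
rewrite /series /= big_nat_recr //= -[\sum_(0 <= k < _) _]/(series _ n.+1) IHn.
have -> : \sum_(i < n.+2) 'C(n.+1, i)%:R *: series b i.+1 =
    \sum_(i < n.+1) 'C(n, i)%:R *: series b i.+1 +
    \sum_(i < n.+1) 'C(n, i)%:R *: series b i.+2.
  rewrite big_ord_recl /= bin0.
  under eq_bigr => i _ do rewrite /bump /= add1n binS natrD scalerDl.
  rewrite big_split /= addrA; congr (_ + _).
  rewrite [RHS]big_ord_recl /= bin0; congr (_ + _).
  rewrite big_ord_recr /= bin_small // scale0r addr0.
  by apply: eq_bigr => i _; rewrite /bump /= add1n.
rewrite exprS mulrC -!scalerA -scalerDr; congr (_ *: _).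
rewrite -[X in X + _ = _](scalerK (_ : 2 != 0)) ?pnatr_eq0 // -scalerDr.
congr (_ *: _); rewrite scaler_nat mulr2n -addrA; congr (_ + _).
rewrite -big_split /=; apply: eq_bigr => i _; rewrite -scalerDr.
by rewrite [in RHS]/series /= big_nat_recr.
Qed.

(** Regularity of the Euler method: S is its own binomial mean, so the error is at most the binomial
    mean of the errors of [series b]. *)
Lemma euler_mcvg b S : mcvg (series b) S ->
  mcvg (series (fun k => 2^-1 ^+ k *: euler_term b k)) S.
Proof.
move=> bS; rewrite /mcvg -(@cvg_shiftS _ (fun n => mnorm (_ n - S))) /=.
apply: (@squeeze0 _ _ (fun n => (\sum_(i < n.+1) 'C(n, i)%:R *
    mnorm (series b i.+1 - S)) * 2^-1 ^+ n)) => [n|]; last first.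
  apply: (@binomial_mean_cvg0 _ (fun i => mnorm (series b i.+1 - S))).
    by move=> i; exact: mnorm_ge0.
  by rewrite (@cvg_shiftS _ (fun n => mnorm (series b n - S))).
rewrite mnorm_ge0 euler_mean.
have {1}-> : S = 2^-1 ^+ n *: \sum_(i < n.+1) 'C(n, i)%:R *: S.
  rewrite -scaler_suml scalerA -natr_sum sum_bin natrX -exprMn mulVf ?pnatr_eq0 //.
  by rewrite expr1n scale1r.
rewrite -scalerBr mnormZ normc_half_pow mulrC.
rewrite ler_wpM2r ?exprn_ge0 ?invr_ge0 // -sumrB.
apply: le_trans (mnorm_sum _ _ _) _; apply: ler_sum => i _.
by rewrite -scalerBr mnormZ normc_nat.
Qed.

Lemma ratio_abscvg u (q : F) n0 : 0 < q < 1 ->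
  (forall n, (n0 <= n)%N -> mnorm (u n.+1) <= q * mnorm (u n)) -> abscvg u.
Proof. by move=> q01; apply: ratio_cvg q01 => n; exact: mnorm_ge0. Qed.

End MatrixSeries.

(** * Identities for Pochhammer symbols *)

Section Rising.
Context (K : numFieldType) (N : nat).
Implicit Types (A B X : 'M[K]_N).

Lemma scalemxMl (a : K) A B : (a *: A) * B = a *: (A * B).
Proof. by rewrite -mulmxE scalemxAl. Qed.

Lemma scalemxMr (a : K) A B : A * (a *: B) = a *: (A * B).
Proof. by rewrite -mulmxE scalemxAr. Qed.

Lemma comm_scalemx (a : K) A B : GRing.comm A B -> GRing.comm A (a *: B).
Proof. by rewrite /GRing.comm scalemxMl scalemxMr => ->. Qed.

Lemma mxpoch0 A : mxpoch A 0 = 1.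
Proof. by rewrite /mxpoch big_ord0. Qed.

Lemma mxpochS A n : mxpoch A n.+1 = mxpoch A n * (A + n%:R).
Proof. by rewrite /mxpoch big_ord_recr /= rmorph_nat. Qed.

Lemma comm_mxpoch A B n : GRing.comm A B -> GRing.comm A (mxpoch B n).
Proof.
move=> AB; apply: commr_prod => k _; apply: commrD => //.
by rewrite rmorph_nat; exact: commr_nat.
Qed.

Lemma comm_mxpoch2 A B m n : GRing.comm A B -> GRing.comm (mxpoch A m) (mxpoch B n).
Proof. by move=> AB; apply: comm_mxpoch; apply/commr_sym/comm_mxpoch/commr_sym. Qed.

Lemma mxpochD A m n : mxpoch A (m + n) = mxpoch A m * mxpoch (A + m%:R) n.
Proof.
elim: n => [|n IHn]; first by rewrite addn0 mxpoch0 mulr1.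
by rewrite addnS !mxpochS IHn -mulrA -addrA -natrD.
Qed.

Lemma mxpochSl A n : mxpoch A n.+1 = A * mxpoch (A + 1) n.
Proof. by rewrite -add1n mxpochD mxpochS mxpoch0 mul1r addr0. Qed.

(** The factors on the left are those of [mxpoch A n], negated and in reverse order. *)
Lemma mxpoch_reflect A n : mxpoch (1 - A - n%:R) n = (-1) ^+ n *: mxpoch A n.
Proof.
elim: n => [|n IHn]; first by rewrite !mxpoch0 scale1r.
rewrite mxpochSl mxpochS -(natr1 n).
have -> : 1 - A - (n%:R + 1) + 1 = 1 - A - n%:R.
  by rewrite opprD addrA subrK.
have -> : 1 - A - (n%:R + 1) = - (A + n%:R).
  by rewrite -addrA -opprD addrA opprD addrC subrK.
rewrite IHn scalemxMr mulNr exprS mulN1r scaleNr scalerN; congr (- (_ *: _)).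
apply: commr_sym; apply: commrD; last exact: commr_nat.
by apply/commr_sym/comm_mxpoch/commr_refl.
Qed.

(* (A)_n / n!, the coefficient of z^n in (1 - z)^(- A). *)
Definition mxrise A n : 'M[K]_N := (n`!%:R)^-1 *: mxpoch A n.

Lemma mxrise0 A : mxrise A 0 = 1.
Proof. by rewrite /mxrise mxpoch0 fact0 invr1 scale1r. Qed.

Lemma comm_mxrise A B n : GRing.comm A B -> GRing.comm A (mxrise B n).
Proof. by move=> AB; apply: comm_scalemx; exact: comm_mxpoch. Qed.

Lemma comm_mxrise2 A B m n : GRing.comm A B -> GRing.comm (mxrise A m) (mxrise B n).
Proof. by move=> AB; apply: comm_mxrise; apply/commr_sym/comm_mxrise/commr_sym. Qed.

Lemma fact_neq0 n : n`!%:R != 0 :> K.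
Proof. by rewrite pnatr_eq0 -lt0n fact_gt0. Qed.

Lemma factZ n A : (n.+1)%:R *: ((n.+1)`!%:R^-1 *: A) = (n`!%:R : K)^-1 *: A.
Proof.
rewrite scalerA; congr (_ *: _).
by rewrite factS natrM invfM mulrA divff ?mul1r // pnatr_eq0.
Qed.

Lemma mxriseS A n : (n.+1)%:R *: mxrise A n.+1 = mxrise A n * (A + n%:R).
Proof. by rewrite factZ mxpochS scalemxMl. Qed.

(** Coefficient form of (1 - z)^(-A) = (1 - z) (1 - z)^(-A-1). *)
Lemma mxrise_add1 A n : mxrise (A + 1) n.+1 = mxrise A n.+1 + mxrise (A + 1) n.
Proof.
apply: (@scalerI _ _ (n.+1)%:R); first by rewrite pnatr_eq0.
rewrite scalerDr !factZ /mxrise mxpochS mxpochSl.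
rewrite scalerA mulrC -scalerA -scalerDr; congr (_ *: _).
have -> : A * mxpoch (A + 1) n = mxpoch (A + 1) n * A.
  by apply: comm_mxpoch; apply: commrD; [exact: commr_refl|exact: commr1].
by rewrite scaler_nat -[X in _ = _ + X]mulr_natr -mulrDr -addrA nat1r.
Qed.

(** Coefficient form of (1 - z)^(-A-B) = (1 - z)^(-A) (1 - z)^(-B). The induction multiplies by n +
    1 = k + (n + 1 - k) and matches A + B + n = (A + k) + (B + n - k). *)
Lemma mxrise_vandermonde A B n : GRing.comm A B ->
  mxrise (A + B) n = \sum_(k < n.+1) mxrise A k * mxrise B (n - k).
Proof.
move=> AB; elim: n => [|n IHn].
  by rewrite big_ord1 !mxrise0 mulr1.
apply: (@scalerI _ _ (n.+1)%:R); first by rewrite pnatr_eq0.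
rewrite mxriseS IHn mulr_suml scaler_sumr.
have split_rhs (k : 'I_n.+2) : n.+1%:R *: (mxrise A k * mxrise B (n.+1 - k)) =
   (k%:R *: mxrise A k) * mxrise B (n.+1 - k)
   + mxrise A k * ((n.+1 - k)%:R *: mxrise B (n.+1 - k)).
  rewrite scalemxMl scalemxMr -scalerDl -natrD subnKC //.
  by rewrite -ltnS.
under [RHS]eq_bigr => k _ do rewrite split_rhs.
rewrite big_split /= [X in _ = X + _]big_ord_recl /= mulr0n scale0r mul0r add0r.
rewrite [X in _ = _ + X]big_ord_recr /= subnn mulr0n scale0r mulr0 addr0 -big_split /=.
apply: eq_bigr => k _; rewrite /bump /= add1n subSS.
have kn : (k <= n)%N by rewrite -ltnS.
rewrite subSn // !mxriseS.
have -> : A + B + n%:R = (A + k%:R) + (B + (n - k)%:R).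
  by rewrite addrACA -natrD subnKC.
rewrite mulrDr -!mulrA; congr (_ * _ + _).
by apply/commr_sym/comm_mxrise/commr_sym/commrD; [apply: commr_sym|exact: commr_nat].
Qed.

(** Both sides are the coefficient of z^l in (1 + z)^M (1 + z)^(-A) = (1 + z)^(M-A). Induction on M
    by Pascal's rule and [mxrise_add1]; M = 0 is the reflection formula. *)
Lemma mxrise_bin_sum A l M :
  \sum_(n < l.+1) ((-1) ^+ n * 'C(M, l - n)%:R) *: mxrise A n =
  mxrise (M%:R - A - l%:R + 1) l.
Proof.
elim: M l => [|M IHM] l.
  rewrite big_ord_recr /= subnn bin0 mulr1 big1 ?add0r => [|n _]; last first.
    by rewrite bin0n subn_eq0 leqNgt ltn_ord mulr0 scale0r.
  rewrite /mxrise.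
  have -> : - A - l%:R + 1 = 1 - A - l%:R by rewrite addrC addrA.
  by rewrite mxpoch_reflect scalerA mulrC -scalerA.
case: l => [|l]; first by rewrite big_ord1 !mxrise0 subnn bin0 mulr1 scale1r.
pose X : 'M[K]_N := M%:R - A - l%:R.
have -> : M.+1%:R - A - l.+1%:R + 1 = X + 1.
  rewrite /X -!natr1 opprD !addrA; congr (_ + _).
  by rewrite -!addrA [1 + _]addrC -!addrA addNr addr0.
rewrite mxrise_add1 -(IHM l).
have -> : X = M%:R - A - l.+1%:R + 1.
  by rewrite -natr1 opprD !addrA subrK.
rewrite -IHM big_ord_recr [X in _ = X + _]big_ord_recr /= !subnn !bin0.
rewrite addrAC -big_split /=; congr (_ + _); apply: eq_bigr => n _.
have nl : (n <= l)%N by rewrite -ltnS.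
by rewrite -scalerDl subSn // binS natrD mulrDr.
Qed.

Lemma mxriseD A j n : 'C(j + n, j)%:R *: mxrise A (j + n) =
  mxrise A j * mxrise (A + j%:R) n.
Proof.
rewrite /mxrise mxpochD scalemxMl scalemxMr !scalerA; congr (_ *: _).
apply: (mulIf (fact_neq0 (j + n))); rewrite mulfVK ?fact_neq0 //.
rewrite -[in RHS](@bin_fact (j + n) j) ?leq_addr // addKn !natrM.
by field; rewrite !fact_neq0.
Qed.

(** Put m = j + n and sum over n first: [mxriseD] splits off [mxrise A j], and [mxrise_bin_sum] at A
    + j, with M = k - 1 and l = k - j, leaves [mxrise (- A) (k - j)]. *)
Lemma binomial_transform_coef A (nu : nat -> 'M[K]_N) k :
  \sum_(m < k.+1) 'C(k.-1, k - m)%:R *: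
     (((-1) ^+ m *: mxrise A m) *
        \sum_(j < m.+1) ((-1) ^+ j * 'C(m, j)%:R) *: nu j) =
  \sum_(j < k.+1) mxrise (- A) (k - j) * (mxrise A j * nu j).
Proof.
(* The integers cancel because the Euler weights have upper index k - 1. For k = 0 the truncated
   [k.-1] is harmless, the degree k - j being 0. *)
have shift (j : nat) : (j <= k)%N ->
    mxrise (k.-1%:R - (A + j%:R) - (k - j)%:R + 1) (k - j) = mxrise (- A) (k - j).
  case: k => [|k] jk; first by rewrite !mxrise0.
  congr mxrise => /=.
  rewrite opprD -!addrA.
  have -> : - j%:R + (- (k.+1 - j)%:R + 1) = - k%:R :> 'M[K]_N.
    by rewrite natrB // -natr1 opprB -!addrA addKr opprD subrK.
  by rewrite addrCA subrr addr0.
pose f j n : 'M[K]_N := ((-1) ^+ n * 'C(k.-1, k - (j + n))%:R) *: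
   (('C(j + n, j)%:R *: mxrise A (j + n)) * nu j).
transitivity (\sum_(0 <= m < k.+1) \sum_(j < m.+1) f j (m - j)%N).
  rewrite big_mkord; apply: eq_bigr => m _.
  rewrite mulr_sumr scaler_sumr; apply: eq_bigr => j _.
  have jm : (j <= m)%N by rewrite -ltnS.
  rewrite /f subnKC // !scalemxMl scalemxMr !scalerA; congr (_ *: _).
  have <- : (-1) ^+ m * (-1) ^+ j = (-1) ^+ (m - j) :> K.
    by rewrite -[X in _ ^+ X * _](subnK jm) exprD -mulrA -exprMn mulrNN mulr1 expr1n mulr1.
  by ring.
rewrite triangle_sum big_mkord; apply: eq_bigr => j _.
have jk : (j <= k)%N by rewrite -ltnS.
have -> : (k.+1 - j = (k - j).+1)%N by rewrite subSn.
rewrite big_mkord /f.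
under eq_bigr => n _ do rewrite mxriseD -mulrA -scalemxMr -scalemxMl subnDA.
rewrite -mulr_sumr -mulr_suml mxrise_bin_sum shift // !mulrA; congr (_ * _).
by apply: comm_mxrise2; apply: commrN; exact: commr_refl.
Qed.

End Rising.

(** * Moments *)

Section Moments.
Context (K : numFieldType) (N : nat).
Implicit Types (A B Q R : 'M[K]_N).

Lemma mulr_invmx A : A \in unitmx -> A * invmx A = 1.
Proof. exact: mulmxV. Qed.

Lemma mulr_invmxl A : A \in unitmx -> invmx A * A = 1.
Proof. exact: mulVmx. Qed.

Lemma invmxM A B : A \in unitmx -> B \in unitmx ->
  invmx (A * B) = invmx B * invmx A.
Proof.
move=> uA uB; have uAB : A * B \in unitmx by rewrite -mulmxE unitmx_mul uA.
rewrite -[RHS]mul1r -(mulr_invmxl uAB) -!mulrA (mulrA B) mulr_invmx // mul1r.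
by rewrite mulr_invmx // mulr1.
Qed.

Lemma comm_invmx A B : GRing.comm A B -> GRing.comm A (invmx B).
Proof.
move=> AB; case: (boolP (B \in unitmx)) => uB; last by rewrite invmx_out.
rewrite /GRing.comm -[LHS]mul1r -(mulr_invmxl uB) -mulrA (mulrA B) -AB.
by rewrite -(mulrA A) mulr_invmx // mulr1.
Qed.

Lemma mxpoch_unit R n : (forall k : nat, R + k%:R \in unitmx) ->
  mxpoch R n \in unitmx.
Proof.
move=> uR; elim: n => [|n IHn]; first by rewrite mxpoch0 unitmx1.
by rewrite mxpochS -mulmxE unitmx_mul IHn uR.
Qed.

Definition moment Q R n : 'M[K]_N := mxpoch Q n * invmx (mxpoch R n).

(** The matrix-valued functional with moments mu: it turns polynomial identities into identities
    between moments. *)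
Definition moment_poly (mu : nat -> 'M[K]_N) (p : {poly K}) : 'M[K]_N :=
  \sum_(i < size p) p`_i *: mu i.

Lemma moment_polyE mu (p : {poly K}) n : (size p <= n)%N ->
  moment_poly mu p = \sum_(i < n) p`_i *: mu i.
Proof.
move=> pn; rewrite /moment_poly (big_ord_widen _ (fun i => p`_i *: mu i) pn).
rewrite big_mkcond /=; apply: eq_bigr => i _; case: ltnP => // pi.
by rewrite nth_default // scale0r.
Qed.

Lemma moment_poly_is_linear mu : linear (moment_poly mu).
Proof.
move=> a p q; pose n := maxn (size (a *: p + q)) (maxn (size p) (size q)).
rewrite !(@moment_polyE _ _ n) ?leq_max ?leqnn ?orbT //.
rewrite scaler_sumr -big_split /=; apply: eq_bigr => i _.
by rewrite coefD coefZ scalerDl scalerA.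
Qed.

HB.instance Definition _ mu := GRing.isLinear.Build K {poly K} 'M[K]_N _
  (moment_poly mu) (moment_poly_is_linear mu).

Lemma moment_polyXn mu n : moment_poly mu 'X^n = mu n.
Proof.
rewrite (@moment_polyE _ _ n.+1) ?size_polyXn // big_ord_recr /= coefXn eqxx.
rewrite scale1r big1 ?add0r // => i _; rewrite coefXn.
by rewrite ltn_eqF ?ltn_ord // scale0r.
Qed.

Section Beta.
Context (Q R : 'M[K]_N) (QR : GRing.comm Q R).
Context (uR : forall k : nat, R + k%:R \in unitmx).

Let invpochS n : invmx (mxpoch R n) = (R + n%:R) * invmx (mxpoch R n.+1).
Proof.
rewrite mxpochS invmxM ?mxpoch_unit // mulrA mulr_invmx //.
by rewrite mul1r.
Qed.

(* The moment functional is formally p |-> B(Q, R-Q)^-1 * the integral over    *)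
(* [0, 1] of t^(Q-1) (1-t)^(R-Q-1) p(t) dt; on p = (1-t)^m t^k it is a         *)
(* quotient of Beta functions.                                                 *)
Lemma moment_beta m k :
  moment_poly (moment Q R) ((1 - 'X) ^+ m * 'X^k) =
  mxpoch Q k * mxpoch (R - Q) m * invmx (mxpoch R (m + k)).
Proof.
elim: m k => [|m IHm] k.
  by rewrite mul1r moment_polyXn mxpoch0 mulr1.
have -> : (1 - 'X) ^+ m.+1 * 'X^k =
    (1 - 'X) ^+ m * 'X^k - (1 - 'X) ^+ m * 'X^(k.+1) :> {poly K}.
  by rewrite exprSr exprS -mulrA mulrBl mulrBr mul1r.
rewrite raddfB /= !IHm addnS addSn invpochS.
set W := invmx _; rewrite !mxpochS.
have -> : mxpoch Q k * (Q + k%:R) * mxpoch (R - Q) m =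
    mxpoch Q k * mxpoch (R - Q) m * (Q + k%:R).
  rewrite -!mulrA; congr (_ * _); apply: comm_mxpoch; apply: commr_sym.
  apply: commrD; last exact: commr_nat.
  by apply/commr_sym/commrB => //; exact: commr_refl.
(* What remains is (R + m + k) - (Q + k) = (R - Q) + m. *)
rewrite !mulrA -mulrBl -mulrBr; congr (_ * _ * _).
by rewrite natrD addrA opprD addrACA subrr addr0 addrAC.
Qed.

(** Evaluate the functional at (1 - X)^m (1 + X)^m, expanding (1 + X)^m for the left side, and at (1
    - X^2)^m for the right side, where only even moments occur. *)
Lemma moment_beta_sum m :
  \sum_(n < m.+1) 'C(m, n)%:R *:
     (mxpoch Q n * mxpoch (R - Q) m * invmx (mxpoch R (m + n))) =
  \sum_(j < m.+1) ((-1) ^+ j * 'C(m, j)%:R) *: moment Q R j.*2.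
Proof.
have <- : moment_poly (moment Q R) ((1 - 'X) ^+ m * (1 + 'X) ^+ m) =
    \sum_(n < m.+1) 'C(m, n)%:R *:
     (mxpoch Q n * mxpoch (R - Q) m * invmx (mxpoch R (m + n))).
  rewrite [(1 + 'X) ^+ m]exprDn mulr_sumr raddf_sum; apply: eq_bigr => n _ /=.
  by rewrite expr1n mul1r mulrnAr raddfMn /= moment_beta scaler_nat.
have -> : (1 - 'X) ^+ m * (1 + 'X) ^+ m = (1 - 'X^2) ^+ m :> {poly K}.
  by rewrite -exprMn; congr (_ ^+ m); ring.
rewrite exprBn raddf_sum; apply: eq_bigr => j _ /=.
rewrite expr1n mulr1 raddfMn /= -exprM mul2n.
have -> : (-1) ^+ j * 'X^(j.*2) = (-1) ^+ j *: 'X^(j.*2) :> {poly K}.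
  by rewrite -signr_odd -[in RHS]signr_odd mulr_sign scaler_sign.
by rewrite linearZ /= moment_polyXn mulrC -scalerA scaler_nat.
Qed.

End Beta.

Lemma bin_pochN m n :
  ((-1) ^+ n / n`!%:R) *: mxpoch (- (m%:R)%:M : 'M[K]_N) n = ('C(m, n)%:R)%:M.
Proof.
elim: n => [|n IHn].
  by rewrite mxpoch0 bin0 fact0 divr1 scale1r.
have n1 : n.+1%:R != 0 :> K by rewrite pnatr_eq0.
have -> : (-1) ^+ n.+1 / n.+1`!%:R = (- (n.+1%:R)^-1) * ((-1) ^+ n / n`!%:R) :> K.
  by rewrite exprS factS natrM invfM mulN1r !mulNr mulrCA.
rewrite -scalerA mxpochS -scalemxMl IHn -(rmorph_nat (@scalar_mx K N)).
rewrite -rmorphN -rmorphD -mulmxE -scalar_mxM scale_scalar_mx; congr _%:M.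
apply: (mulfI n1); rewrite -natrM mul_bin_left natrM mulrA mulrN divff // mulN1r.
case: (leqP n m) => [nm|mn]; last by rewrite bin_small // mul0r mulr0 oppr0.
by rewrite natrB // mulrC -mulNr opprD opprK.
Qed.

(** Duplication, factor by factor: (A/2 + k)((A + 1)/2 + k) = (A + 2k)(A + 2k + 1)/4. *)
Lemma mxpoch_double A m :
  mxpoch (2^-1 *: A) m * mxpoch (2^-1 *: (A + 1)) m =
  (4^-1) ^+ m *: mxpoch A m.*2.
Proof.
elim: m => [|m IHm]; first by rewrite !mxpoch0 mulr1 scale1r.
rewrite doubleS !mxpochS exprSr -scalerA -!mulrA.
rewrite (mulrA (2^-1 *: A + _)).
have -> : (2^-1 *: A + m%:R) * mxpoch (2^-1 *: (A + 1)) m =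
   mxpoch (2^-1 *: (A + 1)) m * (2^-1 *: A + m%:R).
  apply: comm_mxpoch; apply: comm_scalemx; apply: commrD; last exact: commr1.
  apply: commr_sym; apply: commrD; last exact: commr_nat.
  exact: comm_scalemx.
rewrite -!mulrA (mulrA (mxpoch (2^-1 *: A) m)) IHm scalemxMl.
congr (_ *: _); rewrite -scalemxMr; congr (_ * _).
have natE k : k%:R = 2^-1 *: ((k.*2)%:R : 'M[K]_N).
  by rewrite -muln2 natrM mulr_natr -[X in _ *: X]scaler_nat scalerA mulVf ?scale1r //.
rewrite (natE m) -!scalerDr scalemxMl scalemxMr scalerA -invfM.
by rewrite -natrM -addrA nat1r.
Qed.

End Moments.

(** * The binomial series at 1/2 *)

Section OneParameter.
Context (F : realType) (N : nat).
Local Notation M := 'M[F[i]]_N.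
Implicit Types (A B G : M) (x y : F -> nat -> M).

Lemma mcvgB (u v : nat -> M) l m : mcvg u l -> mcvg v m ->
  mcvg (fun n => u n - v n) (l - m).
Proof.
move=> ul vm; apply: (@mcvg_le _ _ _ _ (fun n => mnorm (u n - l) + mnorm (v n - m))).
  move=> n; have -> : u n - v n - (l - m) = (u n - l) - (v n - m).
    by rewrite !opprD !opprK addrACA.
  exact: mnormB.
by rewrite -(addr0 (0 : F)); apply: cvgD.
Qed.

Lemma mcvgZ (a : F[i]) (u : nat -> M) l : mcvg u l ->
  mcvg (fun n => a *: u n) (a *: l).
Proof.
move=> ul; apply: (@mcvg_le _ _ _ _ (fun n => Normc.normc a * mnorm (u n - l))).
  by move=> n; rewrite -scalerBr mnormZ.
by rewrite -(mulr0 (Normc.normc a)); apply: cvgM => //; exact: cvg_cst.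
Qed.

(* The semigroup s |-> sum_n x s n has generator G = sum_n l n. It will be     *)
(* applied to x s n = (s A)_n / n! 2^-n and to x s n = (s A)^n / n!.           *)
Definition semigroup_terms x G : Prop :=
  (forall s t n, x (s + t) n = \sum_(k < n.+1) x s k *m x t (n - k)%N) /\
  exists (l : nat -> M) (w : nat -> F),
   [/\ mcvg (series l) G, cvgn (series w)
     & forall s n, 0 <= s <= 1 -> mnorm (x s n) <= w n /\
         mnorm (x s n - ((n == 0%N)%:R%:M + s%:C%C *: l n)) <= s ^+ 2 * w n].

Lemma mcvg_series_finite (u : nat -> M) n0 :
  (forall n, (n0 <= n)%N -> u n = 0) -> mcvg (series u) (\sum_(k < n0) u k).
Proof.
move=> u0; apply/cvgrPdist_lt => e e0; exists n0 => // n /= n0n.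
have -> : series u n = \sum_(k < n0) u k.
  rewrite /series /= (@big_cat_nat _ _ _ n0 0 n) //= [X in _ + X]big1_seq.
    by rewrite addr0 big_mkord.
  by move=> k; rewrite mem_index_iota => /andP[_ /andP[kn _]]; exact: u0.
by rewrite subrr mnorm0 subrr normr0.
Qed.

(** The Cauchy product gives the semigroup law; the termwise bounds add up, with C the sum of the
    majorant [w]. *)
Lemma semigroup_terms_sum x G : semigroup_terms x G ->
  exists C : F,
  [/\ forall s, 0 <= s <= 1 -> mcvg (series (x s)) (mxseries_sum (x s)),
      forall s t, 0 <= s -> 0 <= t -> s + t <= 1 ->
        mxseries_sum (x (s + t)) = mxseries_sum (x s) *m mxseries_sum (x t),
      forall s, 0 <= s <= 1 -> mnorm (mxseries_sum (x s)) <= C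
    & forall s, 0 <= s <= 1 ->
        mnorm (mxseries_sum (x s) - (1%:M + s%:C%C *: G)) <= s ^+ 2 * C].
Proof.
move=> [xD [l [w [lG cw xw]]]].
have absx s : 0 <= s <= 1 -> abscvg (x s).
  by move=> s01; apply: (abscvg_le _ cw) => n; have [] := xw s n s01.
have sumx s : 0 <= s <= 1 -> mcvg (series (x s)) (mxseries_sum (x s)).
  by move=> /absx/abscvg_mcvg[m xm]; rewrite (mxseries_sumE xm).
have w_ge0 n : 0 <= w n.
  have [|h _] := xw 0 n; first by rewrite lexx ler01.
  exact: le_trans (mnorm_ge0 _) h.
have w_le n : series w n <= limn (series w).
  apply: (nondecreasing_cvgn_le _ cw); apply/nondecreasing_seqP => m.
  by rewrite /series /= big_nat_recr //= lerDl.
exists (limn (series w)); split=> //.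
- move=> s t s0 t0 st1.
  have s01 : 0 <= s <= 1 by apply/andP; split => //; lra.
  have t01 : 0 <= t <= 1 by apply/andP; split => //; lra.
  apply: mxseries_sumE.
  have -> : x (s + t) = fun n => \sum_(k < n.+1) x s k *m x t (n - k)%N.
    by apply/funext => n; exact: xD.
  by apply: mcvg_cauchy; [exact: absx|exact: absx|exact: sumx|exact: sumx].
- move=> s s01; apply: (mnorm_lim_le (sumx s s01)) => n.
  apply: le_trans (mnorm_sum _ _ _) _; apply: le_trans (w_le n).
  by apply: ler_sum => k _; have [] := xw s k s01.
- move=> s s01.
  have one1 : mcvg (series (fun n => (n == 0%N)%:R%:M : M)) 1%:M.
    have := @mcvg_series_finite (fun n => (n == 0%N)%:R%:M) 1; rewrite big_ord1.
    by apply => -[//|n _] /=; rewrite raddf0.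
  have := mcvgB (sumx s s01) (mcvgD one1 (mcvgZ s%:C%C lG)).
  move/mnorm_lim_le; apply => n.
  apply: (@le_trans _ _ (s ^+ 2 * series w n)); last first.
    by rewrite ler_wpM2l ?sqr_ge0.
  rewrite /series /= scaler_sumr -big_split -sumrB /= mulr_sumr.
  apply: le_trans (mnorm_sum _ _ _) _.
  by apply: ler_sum => k _; have [] := xw s k s01.
Qed.

(** X(1) - Y(1) = X(1/n)^n - Y(1/n)^n telescopes into n terms, each O(1/n^2) because X and Y agree
    to first order at 0. *)
Lemma semigroup_unique x y G : semigroup_terms x G -> semigroup_terms y G ->
  mxseries_sum (x 1) = mxseries_sum (y 1).
Proof.
move=> /semigroup_terms_sum[C [_ XD XC X2]] /semigroup_terms_sum[D [_ YD YD' Y2]].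
pose X s := mxseries_sum (x s); pose Y s := mxseries_sum (y s).
pose E := C + D.
have C0 : 0 <= C by apply: le_trans (mnorm_ge0 _) (XC 0 _); rewrite lexx ler01.
have D0 : 0 <= D by apply: le_trans (mnorm_ge0 _) (YD' 0 _); rewrite lexx ler01.
have at0 (z : F -> nat -> M) (b : F) : (forall s, 0 <= s <= 1 ->
    mnorm (mxseries_sum (z s) - (1%:M + s%:C%C *: G)) <= s ^+ 2 * b) ->
    mxseries_sum (z 0) = 1%:M :> M.
  move=> /(_ 0); rewrite lexx ler01 expr0n mul0r scale0r addr0 => /(_ isT) z0.
  apply/eqP; rewrite -subr_eq0; apply/eqP/mnorm_eq0/eqP.
  by rewrite eq_le z0 mnorm_ge0.
have X0 : X 0 = 1%:M := at0 _ _ X2.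
have Y0 : Y 0 = 1%:M := at0 _ _ Y2.
have XY s : 0 <= s <= 1 -> mnorm (X s - Y s) <= s ^+ 2 * E.
  move=> s01; pose L := 1%:M + s%:C%C *: G.
  have -> : X s - Y s = (X s - L) - (Y s - L) by rewrite opprB addrA subrK.
  apply: le_trans (mnormB _ _) _; rewrite mulrDr.
  by apply: lerD; [exact: X2|exact: Y2].
(* The trailing [Y (j%:R * s)] collects the factors already peeled off as one value of Y, bounded by
   D; bounding them one by one would let the constants grow geometrically. *)
have telescope s k j : 0 <= s -> (k + j)%:R * s <= 1 ->
    mnorm ((X (k%:R * s) - Y (k%:R * s)) *m Y (j%:R * s)) <=
    k%:R * (C * (s ^+ 2 * E) * D).
  move=> s0; elim: k j => [|k IHk] j kj.
    by rewrite !mul0r X0 Y0 subrr mul0mx mnorm0.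
  have js0 : 0 <= j%:R * s by rewrite mulr_ge0.
  have ks0 : 0 <= k%:R * s by rewrite mulr_ge0.
  move: kj; rewrite natrD -natr1 !mulrDl mul1r => kj.
  have -> : X (k%:R * s + s) = X (k%:R * s) *m X s by apply: XD => //; lra.
  have -> : Y (k%:R * s + s) = Y (k%:R * s) *m Y s by apply: YD => //; lra.
  have -> : X (k%:R * s) *m X s - Y (k%:R * s) *m Y s =
    X (k%:R * s) *m (X s - Y s) + (X (k%:R * s) - Y (k%:R * s)) *m Y s.
    by rewrite mulmxBr mulmxBl addrA subrK.
  rewrite mulmxDl -!mulmxA.
  have <- : Y (s + j%:R * s) = Y s *m Y (j%:R * s) by apply: YD => //; lra.
  rewrite addrC; apply: le_trans (mnormD _ _) _; apply: lerD.
    have -> : s + j%:R * s = j.+1%:R * s by rewrite -natr1; ring.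
    by apply: IHk; rewrite natrD -natr1; nra.
  apply: le_trans (mnormM _ _) _; rewrite mul1r -mulrA.
  apply: ler_pM; rewrite ?mnorm_ge0 //; first by apply: XC; rewrite ks0; lra.
  apply: le_trans (mnormM _ _) _; apply: ler_pM; rewrite ?mnorm_ge0 //.
    by apply: XY; rewrite s0; lra.
  by apply: YD'; rewrite js0; lra.
pose B := C * E * D.
have B0 : 0 <= B by rewrite /B !mulr_ge0 // addr_ge0.
have small n : mnorm (X 1 - Y 1) * n.+1%:R <= B.
  have n0 : n.+1%:R != 0 :> F by rewrite pnatr_eq0.
  have := telescope n.+1%:R^-1 n.+1 0%N; rewrite addn0 divff // mul0r Y0 mulmx1.
  rewrite invr_ge0 ler0n lexx => /(_ isT isT) h.
  rewrite -ler_pdivlMr ?ltr0n //; apply: le_trans h _.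
  by rewrite le_eqVlt; apply/orP; left; apply/eqP; rewrite /B; field.
apply/eqP; rewrite -subr_eq0; apply/eqP/mnorm_eq0/eqP.
rewrite eq_le mnorm_ge0 andbT leNgt; apply/negP => d0.
have := archi_boundP (divr_ge0 B0 (ltW d0)); set n := Num.bound _ => Bn.
have := small n; rewrite leNgt => /negP; apply.
rewrite mulrC -ltr_pdivrMr //; apply: lt_trans Bn _.
by rewrite ltr_nat.
Qed.

End OneParameter.

Section PowerTwo.
Context (F : realType).

Lemma normc_factV n : Normc.normc (n`!%:R^-1 : F[i]) = n`!%:R^-1.
Proof. by rewrite Normc.normcV normc_nat. Qed.

Definition rpoch (a : F) n : F := \prod_(k < n) (a + k%:R).

Lemma rpochS a n : rpoch a n.+1 = rpoch a n * (a + n%:R).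
Proof. by rewrite /rpoch big_ord_recr. Qed.

Lemma rpoch_ge0 a n : 0 <= a -> 0 <= rpoch a n.
Proof. by move=> a0; apply: prodr_ge0 => k _; rewrite addr_ge0. Qed.

Lemma rpoch_cvg a : 0 <= a ->
  cvgn (series (fun n => 2^-1 ^+ n * (n`!%:R^-1 * rpoch a n))).
Proof.
(* For n >= 2a the ratio (a + n) / (2(n + 1)) is at most 3/4. *)
move=> a0; pose n0 := Num.bound (2 * a).
have q01 : 0 < (3 / 4 : F) < 1 by apply/andP; split; lra.
apply: (@ratio_cvg _ _ (3 / 4) n0 _ q01) => [n|n n0n].
  by rewrite !mulr_ge0 ?rpoch_ge0 ?invr_ge0 ?exprn_ge0 // invr_ge0.
have an : 2 * a <= n%:R.
  apply: (@le_trans _ _ n0%:R); last by rewrite ler_nat.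
  by apply/ltW/archi_boundP; rewrite mulr_ge0.
set t := 2^-1 ^+ n * (n`!%:R^-1 * rpoch a n).
have t0 : 0 <= t by rewrite !mulr_ge0 ?rpoch_ge0 ?invr_ge0 ?exprn_ge0 // invr_ge0.
have n1 : 0 < n.+1%:R :> F by rewrite ltr0n.
have -> : 2^-1 ^+ n.+1 * (n.+1`!%:R^-1 * rpoch a n.+1) =
    t * ((a + n%:R) / (2 * n.+1%:R)).
  by rewrite rpochS exprS factS natrM !invfM /t; ring.
rewrite mulrC ler_wpM2r // ler_pdivrMr ?mulr_gt0 // -natr1; lra.
Qed.

(* The term at n = 0 is 1 / 0 = 0. *)
Definition log2_series : F := limn (series (fun n => 2^-1 ^+ n / n%:R : F)).

Lemma log2_series_cvg : cvgn (series (fun n => 2^-1 ^+ n / n%:R : F)).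
Proof.
apply: (@series_le_cvg _ _ (geometric 1 2^-1)) => [n|n|n|].
- by rewrite divr_ge0 // exprn_ge0 // invr_ge0.
- by rewrite /= mul1r exprn_ge0 // invr_ge0.
- rewrite /= mul1r ler_piMr ?exprn_ge0 ?invr_ge0 //.
  by case: n => [|n]; rewrite ?invr0 ?ler01 // invf_le1 ?ler1n ?ltr0n.
- by apply: is_cvg_geometric_series; rewrite ger0_norm; lra.
Qed.

Section Matrix.
Context (N : nat).
Local Notation M := 'M[F[i]]_N.
Implicit Types (A X : M).

Lemma mulmx_natr X n : X * n%:R = (n%:R : F[i]) *: X.
Proof. by rewrite mulr_natr scaler_nat. Qed.

Lemma mnorm_mul_addn X A (a : F) n : mnorm A <= a ->
  mnorm (X * (A + n%:R)) <= mnorm X * (a + n%:R).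
Proof.
move=> Aa; rewrite mulrDr mulrDr; apply: le_trans (mnormD _ _) _.
apply: lerD.
  by apply: le_trans (mnormM _ _) _; rewrite ler_wpM2l ?mnorm_ge0.
by rewrite mulmx_natr mnormZ normc_nat mulrC.
Qed.

Lemma mnorm_mxpoch A (a : F) n : 0 <= a -> mnorm A <= a ->
  mnorm (mxpoch A n) <= mnorm (1 : M) * rpoch a n.
Proof.
move=> a0 Aa; elim: n => [|n IHn].
  by rewrite mxpoch0 /rpoch big_ord0 mulr1.
rewrite mxpochS rpochS; apply: le_trans (mnorm_mul_addn _ _ Aa) _.
by rewrite mulrA ler_wpM2r // addr_ge0.
Qed.

(** As a polynomial in s, (sA)_(n+1) has linear term n! s A. The higher coefficients are dominated
    by their scalar counterparts at a, and s^k <= s^2 there. *)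
Lemma mnorm_mxpoch_linear A (a s : F) n : 0 <= s <= 1 -> mnorm A <= a ->
  mnorm (mxpoch (s%:C%C *: A) n.+1 - (n`!%:R * s%:C%C) *: A)
    <= s ^+ 2 * (rpoch a n.+1 - n`!%:R * a).
Proof.
move=> /andP[s0 s1] Aa.
have a0 : 0 <= a := le_trans (mnorm_ge0 A) Aa.
have nsA : mnorm (s%:C%C *: A) <= s * a.
  by rewrite mnormZ normcR ger0_norm // ler_wpM2l.
elim: n => [|n IHn].
  rewrite mxpochS mxpoch0 mul1r addr0 fact0 mul1r subrr mnorm0.
  by rewrite /rpoch big_ord1 addr0 mul1r subrr mulr0.
rewrite mxpochS rpochS.
have -> : mxpoch (s%:C%C *: A) n.+1 * (s%:C%C *: A + n.+1%:R)
    - (n.+1`!%:R * s%:C%C) *: A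
  = (mxpoch (s%:C%C *: A) n.+1 - (n`!%:R * s%:C%C) *: A)
       * (s%:C%C *: A + n.+1%:R)
    + (n`!%:R * (s ^+ 2)%:C%C) *: (A * A).
  have LE : (n`!%:R * s%:C%C) *: A * (s%:C%C *: A + n.+1%:R) =
      (n`!%:R * (s ^+ 2)%:C%C) *: (A * A) + (n.+1`!%:R * s%:C%C) *: A.
    rewrite mulrDr scalemxMl scalemxMr scalerA -mulrA -rmorphM -expr2.
    by rewrite mulmx_natr scalerA mulrA -natrM -factS.
  by rewrite mulrBl LE opprD addrA addrAC subrK.
apply: le_trans (mnormD _ _) _.
have AA : mnorm (A * A) <= a * a.
  by apply: le_trans (mnormM _ _) _; apply: ler_pM; rewrite ?mnorm_ge0.
have h1 := mnorm_mul_addn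
  (mxpoch (s%:C%C *: A) n.+1 - (n`!%:R * s%:C%C) *: A) n.+1 nsA.
have sa : s * a + n.+1%:R <= a + n.+1%:R by rewrite lerD2r ler_piMl.
have h2 := ler_wpM2l (mnorm_ge0
  (mxpoch (s%:C%C *: A) n.+1 - (n`!%:R * s%:C%C) *: A)) sa.
have an0 : 0 <= a + n.+1%:R by rewrite addr_ge0.
have h3 := ler_wpM2r an0 IHn.
have h4 : mnorm ((n`!%:R * (s ^+ 2)%:C%C) *: (A * A)) <= n`!%:R * s ^+ 2 * (a * a).
  rewrite mnormZ Normc.normcM normc_nat normcR ger0_norm ?sqr_ge0 //.
  by rewrite ler_wpM2l // mulr_ge0 // sqr_ge0.
apply: le_trans (lerD (le_trans h1 (le_trans h2 h3)) h4) _.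
by rewrite le_eqVlt; apply/orP; left; apply/eqP; rewrite factS natrM; ring.
Qed.

Lemma mcvg_series_scale A (r : nat -> F) : cvgn (series r) ->
  mcvg (series (fun n => (r n)%:C%C *: A)) ((limn (series r))%:C%C *: A).
Proof.
move=> cr.
have -> : series (fun n => (r n)%:C%C *: A) = fun n => (series r n)%:C%C *: A.
  by apply/funext => n; rewrite /series /= rmorph_sum scaler_suml.
apply: (@squeeze0 _ _ (fun n => `|series r n - limn (series r)| * mnorm A)) => [n|].
  by rewrite mnorm_ge0 -scalerBl -rmorphB mnormZ normcR /=.
rewrite -(mul0r (mnorm A)); apply: cvgM; last exact: cvg_cst.
by apply/norm_cvg0P; rewrite -(subrr (limn (series r))); apply: cvgB => //; exact: cvg_cst.
Qed.

Lemma mxrise1 n : mxrise (1 : M) n = 1.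
Proof.
elim: n => [|n IHn]; first exact: mxrise0.
apply: (@scalerI _ _ (n.+1)%:R); first by rewrite pnatr_eq0.
by rewrite mxriseS IHn mul1r nat1r scaler_nat.
Qed.

Lemma scalemx_exp (a : F[i]) A n : (a *: A) ^+ n = a ^+ n *: A ^+ n.
Proof.
elim: n => [|n IHn]; first by rewrite !expr0 scale1r.
by rewrite !exprS IHn scalemxMl scalemxMr scalerA.
Qed.

(** The part of (sA)_n / n! linear in s is (n-1)!/n! A = A/n, whence the generator. *)
Lemma binomial_semigroup A :
  semigroup_terms (fun s n => 2^-1 ^+ n *: mxrise (s%:C%C *: A) n)
    (log2_series%:C%C *: A).
Proof.
split.
  move=> s t n; rewrite rmorphD scalerDl mxrise_vandermonde; last first.
    by apply: comm_scalemx; apply/commr_sym/comm_scalemx; exact: commr_refl.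
  rewrite scaler_sumr; apply: eq_bigr => k _.
  have kn : (k <= n)%N by rewrite -ltnS.
  rewrite mulmxE (scalemxMl (2^-1 ^+ k)) (scalemxMr (2^-1 ^+ (n - k))).
  by rewrite scalerA -exprD subnKC.
pose a := mnorm A; have a0 : 0 <= a := mnorm_ge0 A.
pose l n : M := (2^-1 ^+ n / n%:R)%:C%C *: A.
(* The summand [mnorm 1] serves the size bound, the summand 1 the quadratic remainder. *)
pose w n := (mnorm (1 : M) + 1) * (2^-1 ^+ n * (n`!%:R^-1 * rpoch a n)).
have p0 n : 0 <= 2^-1 ^+ n * (n`!%:R^-1 * rpoch a n).
  by rewrite !mulr_ge0 ?rpoch_ge0 ?invr_ge0 ?exprn_ge0 // invr_ge0.
exists l, w; split.
- exact: (mcvg_series_scale A log2_series_cvg).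
- have -> : series w = fun n => (mnorm (1 : M) + 1) *
      series (fun n => 2^-1 ^+ n * (n`!%:R^-1 * rpoch a n)) n.
    by apply/funext => n; rewrite /series /= mulr_sumr.
  by apply: is_cvgM; [exact: is_cvg_cst|exact: rpoch_cvg].
move=> s n s01; have /andP[s0 s1] := s01; split.
  rewrite mnormZ normc_half_pow mnormZ normc_factV /w mulrDl mul1r.
  apply: (@le_trans _ _ (mnorm (1 : M) * (2^-1 ^+ n * (n`!%:R^-1 * rpoch a n)))).
    rewrite (mulrCA (mnorm _)) ler_wpM2l ?exprn_ge0 ?invr_ge0 //.
    rewrite (mulrCA (mnorm (1 : M))) ler_wpM2l ?invr_ge0 //; apply: mnorm_mxpoch => //.
    by rewrite mnormZ normcR ger0_norm // ler_piMl.
  by rewrite lerDl.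
apply: (@le_trans _ _ (s ^+ 2 * (2^-1 ^+ n * (n`!%:R^-1 * rpoch a n)))); last first.
  by rewrite ler_wpM2l ?sqr_ge0 // /w mulrDl mul1r lerDr mulr_ge0 // mnorm_ge0.
case: n => [|n].
  rewrite mxrise0 /l invr0 mulr0 scale0r scaler0 addr0 eqxx expr0 scale1r.
  by rewrite subrr mnorm0 mulr_ge0 ?sqr_ge0.
have lE : (2^-1 ^+ n.+1 / n.+1%:R)%:C%C = 2^-1 ^+ n.+1 / n.+1%:R :> F[i].
  by rewrite rmorphM rmorphXn !fmorphV !rmorph_nat.
have -> : 2^-1 ^+ n.+1 *: mxrise (s%:C%C *: A) n.+1 -
    ((n.+1 == 0%N)%:R%:M + s%:C%C *: l n.+1) =
  (2^-1 ^+ n.+1 * n.+1`!%:R^-1) *: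
    (mxpoch (s%:C%C *: A) n.+1 - (n`!%:R * s%:C%C) *: A).
  rewrite /= raddf0 add0r /mxrise scalerA scalerBr; congr (_ - _).
  rewrite /l lE !scalerA factS natrM invfM.
  congr (_ *: _); rewrite -!mulrA [s%:C%C * _]mulrC -!mulrA; congr (_ * (_ * _)).
  by rewrite mulrA mulVf ?mul1r // fact_neq0.
rewrite mnormZ Normc.normcM normc_half_pow normc_factV.
rewrite 2!(mulrCA (s ^+ 2)).
apply: (@le_trans _ _ (2^-1 ^+ n.+1 * (n.+1`!%:R^-1 *
    (s ^+ 2 * (rpoch a n.+1 - n`!%:R * a))))).
  rewrite -mulrA; apply: ler_wpM2l; first by rewrite exprn_ge0 // invr_ge0.
  by apply: ler_wpM2l; [rewrite invr_ge0|exact: mnorm_mxpoch_linear].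
apply: ler_wpM2l; first by rewrite exprn_ge0 // invr_ge0.
apply: ler_wpM2l; first by rewrite invr_ge0.
by apply: ler_wpM2l; rewrite ?sqr_ge0 // lerBlDr lerDl mulr_ge0.
Qed.

Lemma mnorm_expr A n : mnorm (A ^+ n) <= mnorm (1 : M) * mnorm A ^+ n.
Proof.
elim: n => [|n IHn]; first by rewrite !expr0 mulr1.
rewrite !exprSr mulrA; apply: le_trans (mnormM _ _) _.
by rewrite ler_wpM2r // mnorm_ge0.
Qed.

Lemma exponential_semigroup A :
  semigroup_terms (fun s n => n`!%:R^-1 *: (s%:C%C *: A) ^+ n) A.
Proof.
split.
  move=> s t n; rewrite rmorphD scalerDl exprDn_comm; last first.
    by apply: comm_scalemx; apply/commr_sym/comm_scalemx; exact: commr_refl.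
  rewrite scaler_sumr (reindex_inj rev_ord_inj) /=; apply: eq_bigr => k _.
  have kn : (k <= n)%N by rewrite -ltnS.
  rewrite subSS subKn // mulmxE (scalemxMl k`!%:R^-1) (scalemxMr (n - k)`!%:R^-1).
  rewrite -[X in _ *: X = _]scaler_nat !scalerA.
  congr (_ *: _); rewrite bin_sub // -(bin_fact kn) !natrM.
  have b0 : 'C(n, k)%:R != 0 :> F[i] by rewrite pnatr_eq0 -lt0n bin_gt0.
  by field; rewrite b0 !fact_neq0.
pose a := mnorm A; have a0 : 0 <= a := mnorm_ge0 A.
pose l n : M := (n == 1%N)%:R *: A.
pose w n := mnorm (1 : M) * exp_coeff a n.
have e0 n : 0 <= exp_coeff a n by exact: exp_coeff_ge0.
have expE s n : 0 <= s -> mnorm (n`!%:R^-1 *: (s%:C%C *: A) ^+ n) <= s ^+ n * w n.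
  move=> s0; rewrite mnormZ normc_factV /w /exp_coeff.
  rewrite scalemx_exp.
  rewrite mnormZ -rmorphXn normcR ger0_norm ?exprn_ge0 //.
  rewrite mulrCA ler_wpM2l ?exprn_ge0 // mulrA mulrC ler_wpM2r ?invr_ge0 //.
  exact: mnorm_expr.
exists l, w; split.
- have := @mcvg_series_finite _ _ l 2.
  rewrite big_ord_recl big_ord1 /l /= scale0r add0r scale1r; apply.
  by move=> [|[|n]] // _; rewrite scale0r.
- have -> : series w = fun n => mnorm (1 : M) * series (exp_coeff a) n.
    by apply/funext => n; rewrite /series /= mulr_sumr.
  by apply: is_cvgM; [exact: is_cvg_cst|exact: is_cvg_series_exp_coeff].
move=> s n /andP[s0 s1].
have w0 : 0 <= w n by rewrite mulr_ge0 // mnorm_ge0.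
split.
  by apply: le_trans (expE s n s0) _; rewrite ler_piMl // exprn_ile1.
(* Degrees 0 and 1 are exactly the linear approximation; from degree 2 on, s^n <= s^2. *)
case: n w0 => [|[|n]] w0.
- rewrite /l fact0 invr1 scale1r expr0 eqxx scale0r scaler0 addr0 subrr mnorm0.
  by rewrite mulr_ge0 ?sqr_ge0.
- rewrite /l (_ : 1`! = 1%N) // invr1 scale1r expr1 /= raddf0 add0r scale1r subrr mnorm0.
  by rewrite mulr_ge0 ?sqr_ge0.
rewrite /l /= raddf0 scale0r scaler0 addr0 subr0.
apply: le_trans (expE s _ s0) _; rewrite ler_wpM2r //.
by rewrite -addn2 exprD ler_piMl ?sqr_ge0 // exprn_ile1.
Qed.

Lemma binomial_sum_log2_series A :
  mxseries_sum (fun n => 2^-1 ^+ n *: mxrise A n) = mxexp (log2_series%:C%C *: A).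
Proof.
have := semigroup_unique (binomial_semigroup A) (exponential_semigroup _).
by rewrite !scale1r.
Qed.

End Matrix.

(** Take the 1 x 1 matrix A = 1: the binomial series is then geometric with sum 2, so exp of
    [log2_series] is 2. *)
Lemma log2_seriesE : log2_series = ln 2.
Proof.
apply: expR_inj; rewrite lnK ?posrE //.
have := @binomial_sum_log2_series 1 1; rewrite /mxexp.
have -> : (fun n => 2^-1 ^+ n *: mxrise 1 n) =
    fun n => (geometric 1 (2^-1 : F) n)%:C%C *: (1 : 'M[F[i]]_1).
  by apply/funext => n; rewrite mxrise1 /= mul1r rmorphXn fmorphV rmorph_nat.
have -> : (fun k => k`!%:R^-1 *: (log2_series%:C%C *: 1) ^+ k) =
    fun n => (exp_coeff log2_series n)%:C%C *: (1 : 'M[F[i]]_1).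
  apply/funext => n; rewrite scalemx_exp expr1n scalerA /exp_coeff.
  by rewrite mulrC rmorphM rmorphXn fmorphV rmorph_nat.
have half : `|2^-1 : F| < 1 by rewrite ger0_norm; lra.
have geo := @cvg_geometric_series _ 1 (2^-1 : F) half.
rewrite (mxseries_sumE (mcvg_series_scale _ (cvgP _ geo))).
rewrite (mxseries_sumE (mcvg_series_scale _ (@is_cvg_series_exp_coeff _ _))).
rewrite (cvg_lim (@norm_hausdorff _ _) geo).
move/matrixP/(_ 0 0); rewrite !mxE eqxx !mulr1 => /complexI twoE.
have half2 : 1 - 2^-1 = 2^-1 :> F by lra.
by rewrite /expR -twoE half2 invrK mul1r.
Qed.

(* The binomial series (1 - z)^(- A) at z = 1/2. *)
Lemma binomial_sum_half (N : nat) (A : 'M[F[i]]_N) :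
  mcvg (series (fun n => 2^-1 ^+ n *: mxrise A n)) (mxpowR 2 A).
Proof.
rewrite /mxpowR -log2_seriesE -binomial_sum_log2_series.
have [C [/(_ 1) + _ _ _]] := semigroup_terms_sum (binomial_semigroup A).
by rewrite ler01 lexx scale1r; apply.
Qed.

Lemma binomial_half_abscvg (N : nat) (A : 'M[F[i]]_N) :
  abscvg (fun n => 2^-1 ^+ n *: mxrise A n).
Proof.
have [_ [l [w [_ cw xw]]]] := binomial_semigroup A.
apply: (abscvg_le _ cw) => n; have [] := xw 1 n; first by rewrite ler01 lexx.
by rewrite scale1r.
Qed.

(** By Vandermonde the Cauchy product of the binomial series of A and -A is that of 0, whose only
    nonzero term is the identity. *)
Lemma mxpowRN (N : nat) (A : 'M[F[i]]_N) : mxpowR 2 A *m mxpowR 2 (- A) = 1%:M.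
Proof.
apply: (mcvg_unique (u := series (fun n => 2^-1 ^+ n *: mxrise (0 : 'M[F[i]]_N) n))).
  have <- : (fun n => \sum_(k < n.+1) (2^-1 ^+ k *: mxrise A k) *m
     (2^-1 ^+ (n - k) *: mxrise (- A) (n - k))) =
     fun n => 2^-1 ^+ n *: mxrise (0 : 'M[F[i]]_N) n.
    apply/funext => n; rewrite -[in RHS](subrr A) mxrise_vandermonde.
      rewrite scaler_sumr; apply: eq_bigr => k _.
      have kn : (k <= n)%N by rewrite -ltnS.
      rewrite mulmxE (scalemxMl (2^-1 ^+ k)) (scalemxMr (2^-1 ^+ (n - k))).
      by rewrite scalerA -exprD subnKC.
    by apply: commrN; exact: commr_refl.
  exact: (mcvg_cauchy (@binomial_half_abscvg _ A) (@binomial_half_abscvg _ (- A))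
    (@binomial_sum_half _ A) (@binomial_sum_half _ (- A))).
have := @mcvg_series_finite _ _ (fun n => 2^-1 ^+ n *: mxrise (0 : 'M[F[i]]_N) n) 1.
rewrite big_ord1 mxrise0 expr0 scale1r; apply => -[//|n _].
by rewrite /mxrise mxpochSl mul0r !scaler0.
Qed.

End PowerTwo.

(** * The two sides of the theorem *)

Section TheoremTerms.
Context (F : realType) (N : nat).
Local Notation M := 'M[F[i]]_N.
Implicit Types (A B P Q R X : M).

(** If R + k were singular, -k would be an eigenvalue of R. *)
Lemma positive_stable_unit R : positive_stable R ->
  forall k : nat, R + k%:R \in unitmx.
Proof.
move=> stabR k; apply: contraT => nuR.
have : eigenvalue R (- k%:R).
  rewrite /eigenvalue /eigenspace kermx_eq0 row_free_unit.
  by rewrite rmorphN opprK rmorph_nat.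
move/stabR; rewrite -(rmorph_nat (real_complex F)) raddfN /=.
by rewrite ltNge oppr_le0 ler0n.
Qed.

(** The inverse Y of R + n satisfies nY = 1 - RY, so (n - |R|) |Y| <= |1|. *)
Lemma mnorm_invmx_small R B (d : F) : 0 < d ->
  (forall k : nat, R + k%:R \in unitmx) ->
  exists n0, forall n, (n0 <= n)%N -> mnorm (B * invmx (R + n%:R)) <= d.
Proof.
move=> d0 uR; pose t := mnorm B * mnorm (1 : M) / d.
have t0 : 0 <= t by rewrite /t divr_ge0 ?mulr_ge0 ?mnorm_ge0 // ltW.
exists (Num.bound (mnorm R + t)) => n n0n.
have n_big : mnorm R + t < n%:R.
  apply: lt_le_trans (archi_boundP _) _; first by rewrite addr_ge0 ?mnorm_ge0.
  by rewrite ler_nat.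
set Y := invmx _.
have YE : n%:R *: Y = 1 - R * Y.
  have <- : (R + n%:R) * Y = 1 by exact: mulr_invmx.
  by rewrite mulrDl addrC addKr mulr_natl scaler_nat.
have nY : n%:R * mnorm Y <= mnorm (1 : M) + mnorm R * mnorm Y.
  rewrite -[X in X * mnorm _]normc_nat -mnormZ YE; apply: le_trans (mnormB _ _) _.
  by rewrite lerD2l; exact: mnormM.
apply: le_trans (mnormM _ _) _.
have nR : 0 < n%:R - mnorm R by lra.
rewrite -(ler_pM2r nR) -mulrA.
apply: (@le_trans _ _ (mnorm B * mnorm (1 : M))).
  by rewrite ler_wpM2l ?mnorm_ge0 // mulrC mulrBl; lra.
apply: (@le_trans _ _ (d * t)); first by rewrite /t [d * _]mulrC divfK // gt_eqF.
by rewrite ler_wpM2l ?ltW //; lra.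
Qed.

(** (Q + n)(R + n)^-1 = 1 + (Q - R)(R + n)^-1. *)
Lemma mnorm_ratio_near1 Q R (d : F) : 0 < d ->
  (forall k : nat, R + k%:R \in unitmx) ->
  exists n0, forall n, (n0 <= n)%N -> forall X,
    mnorm (X * ((Q + n%:R) * invmx (R + n%:R))) <= mnorm X * (1 + d).
Proof.
move=> d0 uR; have [n0 n0P] := mnorm_invmx_small (Q - R) d0 uR.
exists n0 => n /n0P small X.
have -> : Q + n%:R = (R + n%:R) + (Q - R) by rewrite [RHS]addrAC [R + _]addrCA subrr addr0.
rewrite mulrDl mulr_invmx // mulrDr mulr1; apply: le_trans (mnormD _ _) _.
rewrite mulrDr mulr1 lerD2l; apply: le_trans (mnormM _ _) _.
by rewrite ler_wpM2l ?mnorm_ge0.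
Qed.

Lemma mnorm_addn_near1 P (d : F) : 0 < d ->
  exists n0, forall n, (n0 <= n)%N -> forall X,
    mnorm (n.+1%:R^-1 *: ((P + n%:R) * X)) <= (1 + d) * mnorm X.
Proof.
move=> d0; exists (Num.bound (mnorm (P - 1) / d)) => n n0n X.
have n1 : 0 < n.+1%:R :> F by rewrite ltr0n.
have n_big : mnorm (P - 1) <= d * n.+1%:R.
  rewrite mulrC -ler_pdivrMr //; apply/ltW.
  apply: lt_le_trans (archi_boundP _) _; first by rewrite divr_ge0 ?mnorm_ge0 ?ltW.
  by rewrite ler_nat leqW.
rewrite mnormZ Normc.normcV normc_nat mulrC ler_pdivrMr //.
have -> : P + n%:R = n.+1%:R + (P - 1) by rewrite -nat1r [RHS]addrC addrA subrK.
rewrite mulrDl; apply: le_trans (mnormD _ _) _.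
rewrite mulr_natl -scaler_nat mnormZ normc_nat.
have := mnormM (P - 1) X; have := mnorm_ge0 X; rewrite mulmxE.
nra.
Qed.

Lemma momentS Q R n : GRing.comm Q R -> (forall k : nat, R + k%:R \in unitmx) ->
  moment Q R n.+1 = moment Q R n * ((Q + n%:R) * invmx (R + n%:R)).
Proof.
move=> QR uR; rewrite /moment 2!mxpochS (invmxM (mxpoch_unit n uR) (uR n)) -!mulrA.
congr (_ * _); rewrite mulrA; apply/commr_sym/commrM.
  apply/commr_sym/comm_invmx/comm_mxpoch/commr_sym.
  by apply: commrD; [exact: commr_sym|exact: commr_nat].
apply/commr_sym/comm_invmx/commr_sym/comm_invmx/commr_sym/comm_mxpoch/commr_sym.
by apply: commrD; [exact: commr_refl|exact: commr_nat].
Qed.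

Lemma mnorm_half_pow n X : mnorm (2^-1 ^+ n *: X) = 2^-1 ^+ n * mnorm X.
Proof. by rewrite mnormZ normc_half_pow. Qed.

(** Ratio test: a step brings the factor 1/2, one factor from P and two from the moments, each of
    the three at most 11/10 eventually; (11/10)^3 / 2 < 3/4. *)
Lemma lhs_abscvg P Q R : GRing.comm Q R ->
  (forall k : nat, R + k%:R \in unitmx) ->
  abscvg (fun j => 2^-1 ^+ j *: (mxrise P j * moment Q R j.*2)).
Proof.
move=> QR uR; have d0 : 0 < (10^-1 : F) by rewrite invr_gt0.
have [n1 n1P] := mnorm_ratio_near1 Q d0 uR.
have [n2 n2P] := mnorm_addn_near1 P d0.
have q01 : 0 < (3 / 4 : F) < 1 by apply/andP; split; lra.
apply: (ratio_abscvg (n0 := maxn n1 n2) q01) => n; rewrite geq_max => /andP[n1n n2n].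
have n1n2 : (n1 <= n.*2)%N by rewrite -addnn (leq_trans n1n) // leq_addr.
have := n2P n n2n (mxrise P n * moment Q R n.*2).
rewrite (mulrA (P + n%:R)) -scalemxMl.
have <- : mxrise P n.+1 = n.+1%:R^-1 *: ((P + n%:R) * mxrise P n).
  apply: (@scalerI _ _ (n.+1)%:R); first by rewrite pnatr_eq0.
  rewrite mxriseS scalerA divff ?pnatr_eq0 // scale1r.
  apply: commr_sym; apply: comm_mxrise; apply: commr_sym; apply: commrD.
    exact: commr_refl.
  exact: commr_nat.
have := n1P _ n1n2 (mxrise P n.+1 * moment Q R n.*2).
rewrite -mulrA -momentS //.
have := n1P _ (leqW n1n2) (mxrise P n.+1 * moment Q R n.*2.+1).
rewrite -mulrA -momentS // -doubleS.
move: (mxrise P n.+1 * moment Q R n.*2) (mxrise P n.+1 * moment Q R n.*2.+1).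
move: (mxrise P n.+1 * moment Q R n.+1.*2) (mxrise P n * moment Q R n.*2).
move=> Z X Y W h3 h2 h1; rewrite 2!mnorm_half_pow exprS.
have p0 : 0 <= (2^-1 : F) ^+ n by rewrite exprn_ge0 // invr_ge0.
have x0 := mnorm_ge0 X.
have ZX : 2^-1 * mnorm Z <= 3 / 4 * mnorm X by lra.
by rewrite mulrAC [leLHS]mulrC (mulrCA (3 / 4)) ler_wpM2l.
Qed.

(** C(k-1, k-m) = C(k-1, m-1) for m >= 1; the added m = 0 term vanishes unless k = 0, where it is
    [b 0]. *)
Lemma euler_termE (b : nat -> M) k :
  euler_term b k = \sum_(m < k.+1) 'C(k.-1, k - m)%:R *: b m.
Proof.
case: k => [|k]; first by rewrite big_ord1 /= scale1r.
rewrite big_ord_recl /= subn0 bin_small // scale0r add0r.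
apply: eq_bigr => m _; rewrite /bump /= add1n subSS bin_sub //.
by rewrite -ltnS.
Qed.

Lemma lhs_termE P Q R j : GRing.comm Q R ->
  (forall k : nat, R + k%:R \in unitmx) ->
  pFq_term [:: P; 2^-1 *: Q; 2^-1 *: (Q + 1%:M)]
           [:: 2^-1 *: R; 2^-1 *: (R + 1%:M)] 2^-1 j =
  2^-1 ^+ j *: (mxrise P j * moment Q R j.*2).
Proof.
move=> QR uR; rewrite /pFq_term !big_cons !big_nil !mulr1.
have p4 : (4^-1 : F[i]) ^+ j != 0 by rewrite expf_neq0 // invr_neq0 // pnatr_eq0.
have dR := mxpoch_double R j; have dQ := mxpoch_double Q j.
have uR2 : (4^-1 : F[i]) ^+ j *: mxpoch R j.*2 \in unitmx.
  by rewrite unitmxZ ?unitfE // mxpoch_unit.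
have /andP[u1 u2] : (mxpoch (2^-1 *: R) j \in unitmx)
    && (mxpoch (2^-1 *: (R + 1)) j \in unitmx).
  by rewrite -unitmx_mul mulmxE dR.
have -> : invmx (mxpoch (2^-1 *: R) j) * invmx (mxpoch (2^-1 *: (R + 1%:M)) j) =
    ((4^-1 : F[i]) ^+ j)^-1 *: invmx (mxpoch R j.*2).
  rewrite -invmxM // -invmxZ // -dR; congr invmx.
  apply: comm_mxpoch2; apply: comm_scalemx; apply/commr_sym/comm_scalemx.
  by apply: commrD; [exact: commr_refl|exact: commr1].
rewrite dQ (scalemxMr (4^-1 ^+ j)) (scalemxMl (4^-1 ^+ j)).
rewrite (scalemxMr (4^-1 ^+ j)^-1) (scalerA (4^-1 ^+ j)) divff // scale1r.
by rewrite /mxrise /moment (scalemxMl j`!%:R^-1) scalerA mulrA.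
Qed.

Lemma mcvg_lhs P Q R : GRing.comm Q R -> (forall k : nat, R + k%:R \in unitmx) ->
  exists l, mcvg (series (pFq_term [:: P; 2^-1 *: Q; 2^-1 *: (Q + 1%:M)]
           [:: 2^-1 *: R; 2^-1 *: (R + 1%:M)] 2^-1)) l.
Proof.
move=> QR uR; apply: abscvg_mcvg.
have -> : pFq_term [:: P; 2^-1 *: Q; 2^-1 *: (Q + 1%:M)]
    [:: 2^-1 *: R; 2^-1 *: (R + 1%:M)] 2^-1 =
    fun j => 2^-1 ^+ j *: (mxrise P j * moment Q R j.*2).
  by apply/funext => j; exact: lhs_termE.
exact: lhs_abscvg.
Qed.

Lemma pFq_terminating Q R m :
  pFq [:: - (m%:R)%:M; Q] [:: R + (m%:R)%:M] (-1) =
  \sum_(n < m.+1) 'C(m, n)%:R *: (mxpoch Q n * invmx (mxpoch (R + m%:R) n)).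
Proof.
have termE n : pFq_term [:: - (m%:R)%:M; Q] [:: R + (m%:R)%:M] (-1) n =
    'C(m, n)%:R *: (mxpoch Q n * invmx (mxpoch (R + m%:R) n)).
  rewrite /pFq_term !big_cons !big_nil !mulr1 -mulrA -scalemxMl bin_pochN.
  have -> : (m%:R)%:M = m%:R :> M by rewrite rmorph_nat.
  exact: mul_scalar_mx.
rewrite /pFq.
have -> : pFq_term [:: - (m%:R)%:M; Q] [:: R + (m%:R)%:M] (-1) = fun n =>
    'C(m, n)%:R *: (mxpoch Q n * invmx (mxpoch (R + m%:R) n)).
  exact/funext.
apply: mxseries_sumE; apply: mcvg_series_finite => n mn.
by rewrite bin_small // scale0r.
Qed.

(** Since (R)_(m+n) = (R)_m (R + m)_n, the outer inverse merges with those of the terminating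
    series, giving the sum of [moment_beta_sum]. *)
Lemma rhs_termE P Q R m : GRing.comm Q R ->
  (forall k : nat, R + k%:R \in unitmx) ->
  mxbinN P m *m mxpoch (R - Q) m *m invmx (mxpoch R m)
    *m pFq [:: - (m%:R)%:M; Q] [:: R + (m%:R)%:M] (-1) =
  ((-1) ^+ m *: mxrise P m) *
     \sum_(j < m.+1) ((-1) ^+ j * 'C(m, j)%:R) *: moment Q R j.*2.
Proof.
move=> QR uR; rewrite pFq_terminating -(moment_beta_sum QR uR) !mulmxE.
have -> : (-1) ^+ m *: mxrise P m = mxbinN P m.
  by rewrite /mxrise /mxbinN scalerA.
rewrite -!mulrA; congr (_ * _); rewrite !mulr_sumr; apply: eq_bigr => n _.
rewrite scalemxMr (scalemxMr 'C(m, n)%:R); congr (_ *: _).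
have uRm (k : nat) : R + m%:R + k%:R \in unitmx by rewrite -addrA -natrD.
have RmR : GRing.comm R (R + m%:R) by apply: commrD; [exact: commr_refl|exact: commr_nat].
rewrite mxpochD invmxM ?mxpoch_unit //.
have -> : mxpoch Q n * mxpoch (R - Q) m = mxpoch (R - Q) m * mxpoch Q n.
  by apply: comm_mxpoch2; apply: commrB => //; exact: commr_refl.
rewrite -!mulrA; congr (_ * _); rewrite mulrA.
have -> : invmx (mxpoch R m) * mxpoch Q n = mxpoch Q n * invmx (mxpoch R m).
  by apply/commr_sym/comm_invmx/comm_mxpoch2.
rewrite -mulrA; congr (_ * _).
by apply/comm_invmx/commr_sym/comm_invmx/commr_sym/comm_mxpoch2.
Qed.

End TheoremTerms.

(* The right-hand series does not converge for every P (scalar example:        *)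
(* P = 10, Q = 1, R = 2), so the identity is asserted whenever its sum exists; *)
(* convergence of the left-hand series is part of the conclusion.              *)
Theorem theorem2p3 (F : realType) (N : nat) (P Q R : 'M[F[i]]_N)
    (commPQ : comm_mx P Q) (commPR : comm_mx P R) (commQR : comm_mx Q R)
    (stabQ : positive_stable Q) (stabR : positive_stable R)
    (stabRQ : positive_stable (R - Q)) :
  let lhs_num := [:: P; 2^-1 *: Q; 2^-1 *: (Q + 1%:M)] in
  let lhs_den := [:: 2^-1 *: R; 2^-1 *: (R + 1%:M)] in
  let rhs_term (m : nat) :=
    mxbinN P m *m mxpoch (R - Q) m *m invmx (mxpoch R m)
      *m pFq [:: - (m%:R)%:M; Q] [:: R + (m%:R)%:M] (-1) in
  mxseries_cvg (pFq_term lhs_num lhs_den 2^-1) /\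
  (mxseries_cvg rhs_term ->
   pFq lhs_num lhs_den 2^-1 = mxpowR 2 P *m mxseries_sum rhs_term).
Proof.
move=> lhs_num lhs_den rhs_term.
have uR := positive_stable_unit stabR.
have QR : GRing.comm Q R by exact: commQR.
have [L lhsL] := mcvg_lhs P QR uR.
split; first by apply/mxseries_cvgP; exists L.
move=> /mxseries_cvgP[S rhsS].
rewrite /pFq (mxseries_sumE lhsL) (mxseries_sumE rhsS).
have rhsE : rhs_term = fun m => ((-1) ^+ m *: mxrise P m) *
     \sum_(j < m.+1) ((-1) ^+ j * 'C(m, j)%:R) *: moment Q R j.*2.
  by apply/funext => m; exact: rhs_termE.
have lhsE : pFq_term lhs_num lhs_den 2^-1 =
    fun j => 2^-1 ^+ j *: (mxrise P j * moment Q R j.*2).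
  by apply/funext => j; exact: lhs_termE.
(* The Euler transform of the right-hand series is the Cauchy product of the binomial series of -P
   with the left-hand series. *)
have eulerE : (fun k => 2^-1 ^+ k *: euler_term rhs_term k) =
    fun k => \sum_(j < k.+1) (2^-1 ^+ j *: mxrise (- P) j) *m
      (2^-1 ^+ (k - j) *: (mxrise P (k - j) * moment Q R (k - j).*2)).
  apply/funext => k; rewrite euler_termE rhsE.
  rewrite (binomial_transform_coef P (fun j => moment Q R j.*2)).
  rewrite scaler_sumr (reindex_inj rev_ord_inj) /=; apply: eq_bigr => j _.
  have jk : (j <= k)%N by rewrite -ltnS.
  rewrite subSS subKn // mulmxE (scalemxMl (2^-1 ^+ j)).
  by rewrite (scalemxMr (2^-1 ^+ (k - j))) scalerA -exprD subnKC.
have := euler_mcvg rhsS; rewrite eulerE => transformS.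
move: lhsL; rewrite lhsE => lhsL.
have := mcvg_cauchy (@binomial_half_abscvg _ _ (- P)) (@lhs_abscvg _ _ P Q R QR uR)
  (@binomial_sum_half _ _ (- P)) lhsL.
(* Uniqueness of limits gives S = 2^(-P) L; multiplying by 2^P returns L. *)
move=> /(mcvg_unique transformS) ->.
by rewrite mulmxA mxpowRN mul1mx.
Qed.
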